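(* Let $(E,i,q)$ be a twist over a countable discrete group $G$. Suppose that $\{t_\varepsilon:\varepsilon\in E\}$ is a family of unitary elements of a unital C*-algebra $A$ such that $t_{z\cdot\varepsilon}=\overline{z}\,t_\varepsilon$ and $t_\varepsilon t_\zeta=t_{\varepsilon\zeta}$ for all $\varepsilon,\zeta\in E$ and $z\in\mathbb{T}$. Then there is a $*$-homomorphism $\pi_t\colon C^*(G;E)\to A$ satisfying $\pi_t(\delta^{\mathbb{T}}_\varepsilon)=t_\varepsilon$ for each $\varepsilon\in E$, where $\delta^{\mathbb{T}}_\varepsilon\colon E\to\mathbb{C}$ is given by $\delta^{\mathbb{T}}_\varepsilon(w\cdot\varepsilon)=w$ for $w\in\mathbb{T}$ and $\delta^{\mathbb{T}}_\varepsilon(\zeta)=0$ if $\zeta\ne w\cdot\varepsilon$ for all $w\in\mathbb{T}$.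
   Context: A twist $(E,i,q)$ over a countable discrete group $G$ (with identity $e$) is a central extension $\mathbb{T}\xrightarrow{i}E\xrightarrow{q}G$: $E$ is a locally compact Hausdorff group; $i$ is a continuous injective homomorphism and $q$ is a continuous surjective homomorphism with $i(\mathbb{T})=q^{-1}(e)$; $i(\mathbb{T})$ is central in $E$; and for each $\alpha\in G$ there is $P_\alpha\in q^{-1}(\alpha)$ such that $z\mapsto i(z)P_\alpha$ is a homeomorphism of $\mathbb{T}$ onto the open set $q^{-1}(\alpha)$. Write $z\cdot\varepsilon=i(z)\varepsilon$ for $z\in\mathbb{T}$, $\varepsilon\in E$. Let $\lambda$ be the measure on $E$ that on each $q^{-1}(\alpha)$ is the copy of normalised Haar measure on $\mathbb{T}$ under $z\mapsto z\cdot\varepsilon$ (any $\varepsilon\in q^{-1}(\alpha)$). $\Sigma_c(G;E)$ is the $*$-algebra of $f\in C_c(E)$ with $f(z\cdot\varepsilon)=zf(\varepsilon)$ for all $z\in\mathbb{T},\varepsilon\in E$, with product $(fg)(\varepsilon)=\int_E f(\varepsilon\zeta^{-1})g(\zeta)\,d\lambda(\zeta)$ and involution $f^*(\varepsilon)=\overline{f(\varepsilon^{-1})}$. $C^*(G;E)$ is the completion of $\Sigma_c(G;E)$ in the full norm $\|f\|=\sup\{\|\pi(f)\|:\pi\text{ a }*\text{-representation of }\Sigma_c(G;E)\text{ on a Hilbert space}\}$. The functions $\delta^{\mathbb{T}}_\varepsilon$ belong to $\Sigma_c(G;E)$. *)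

(* Defs.v *)
From HB Require Import structures.
From mathcomp Require Import all_boot all_order all_algebra.
From mathcomp Require Import complex.
From mathcomp Require Import all_classical all_reals all_analysis.
From mathcomp Require Import measurable_realfun.

Set Implicit Arguments.
Unset Strict Implicit.
Unset Printing Implicit Defensive.

Import Order.TTheory GRing.Theory Num.Theory.
Import numFieldNormedType.Exports.

Local Open Scope classical_set_scope.
Local Open Scope ring_scope.

(* The norm of a normed space over R[i] takes its values in R[i]. *)
#[non_forgetful_inheritance]
HB.instance Definition _ (R : realType) := NormedModule.copy R[i] (R[i]^o).

HB.mixin Record isTopologicalGroup E & Group E & Topological E := {
  mulg_continuous : continuous (fun p : E * E => (p.1 * p.2)%g) ;
  invg_continuous : continuous (fun x : E => x^-1%g) ;
}.

#[short(type="topologicalGroupType")]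
HB.structure Definition TopologicalGroup :=
  {E of isTopologicalGroup E & Group E & Topological E}.

HB.instance Definition _ (E : topologicalGroupType) := isPointed.Build E 1%g.

Definition borel (T : ptopologicalType) := g_sigma_algebraType (@open T).

Lemma measurable_fun_borel d (S : measurableType d) (T : ptopologicalType)
    (f : S -> borel T) :
  (forall U : set T, open U -> measurable (f @^-1` U)) ->
  measurable_fun [set: S] f.
Proof.
move=> mf; apply: (@measurability _ _ S (borel T) setT f (@open T)) => //.
by move=> _ [U oU <-]; rewrite setTI; exact: mf.
Qed.

Lemma continuous_measurable_borel (S T : ptopologicalType) (f : S -> T) :
  continuous f -> measurable_fun [set: borel S] (f : borel S -> borel T).
Proof.
move=> cf; apply: measurable_fun_borel => U oU.
by apply: sub_sigma_algebra; move/continuousP: cf; apply.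
Qed.

Lemma pushforward_semi_sigma_additive d d' (S : measurableType d)
    (T : measurableType d') (R : realType) (mu : {measure set S -> \bar R})
    (f : S -> T) :
  measurable_fun [set: S] f -> semi_sigma_additive (pushforward mu f).
Proof.
move=> mf F mF tF mUF; rewrite /pushforward preimage_bigcup.
apply: measure_semi_sigma_additive.
- by move=> n; rewrite -[X in measurable X]setTI; exact: mf.
- apply/trivIsetP => /= i j _ _ ij; rewrite -preimage_setI.
  by move/trivIsetP : tF => /(_ _ _ _ _ ij) ->//; rewrite preimage_set0.
- by rewrite -preimage_bigcup -[X in measurable X]setTI; exact: mf.
Qed.

Lemma continuous_complex (R : realType) : continuous (fun x : R => x%:C%C).
Proof.
move=> x; apply/cvgrPdist_lt => e e0.
have [er -> er0] : exists2 er : R, e = er%:C%C & 0 < er.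
  by case: e e0 => a b; rewrite ltcE /= => /andP[/eqP -> ?]; exists a.
apply/nbhs_ballP; exists er => //= y; rewrite /ball /= => xy.
by rewrite -rmorphB normc_def /= expr0n /= addr0 sqrtr_sqr ltcR.
Qed.

Section circle.
Variable R : realType.

Record circle := Circle { circle_val :> R[i]; _ : `|circle_val| == 1 }.

HB.instance Definition _ := [isSub for circle_val].
HB.instance Definition _ := [Choice of circle by <:].
HB.instance Definition _ := Topological.copy circle (initial_topology circle_val).

Lemma circle_neq0 (z : circle) : val z != 0.
Proof. by rewrite -normr_eq0; case: z => z /= /eqP ->; exact: oner_neq0. Qed.

Lemma circle_normE (z : circle) : `|val z| = 1.
Proof. by case: z => z /= /eqP. Qed.

Fact circle_one_subproof : `|1 : R[i]| == 1. Proof. by rewrite normr1. Qed.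
Fact circle_mul_subproof (z w : circle) : `|val z * val w| == 1.
Proof. by rewrite normrM !circle_normE mulr1. Qed.
Fact circle_inv_subproof (z : circle) : `|(val z)^-1| == 1.
Proof. by rewrite normfV circle_normE invr1. Qed.

Definition circle_one := Circle circle_one_subproof.
Definition circle_mul z w := Circle (circle_mul_subproof z w).
Definition circle_inv z := Circle (circle_inv_subproof z).

Fact circle_mulA : associative circle_mul.
Proof. by move=> x y z; apply: val_inj; rewrite /= mulrA. Qed.
Fact circle_mul1 : left_id circle_one circle_mul.
Proof. by move=> x; apply: val_inj; rewrite /= mul1r. Qed.
Fact circle_1mul : right_id circle_one circle_mul.
Proof. by move=> x; apply: val_inj; rewrite /= mulr1. Qed.
Fact circle_mulV : left_inverse circle_one circle_inv circle_mul.
Proof. by move=> x; apply: val_inj; rewrite /= mulVf// circle_neq0. Qed.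
Fact circle_Vmul : right_inverse circle_one circle_inv circle_mul.
Proof. by move=> x; apply: val_inj; rewrite /= mulfV// circle_neq0. Qed.

HB.instance Definition _ :=
  isGroup.Build circle circle_mulA circle_mul1 circle_1mul circle_mulV circle_Vmul.
HB.instance Definition _ := isPointed.Build circle 1%g.

Fact expi_subproof (t : R) : `|(cos t +i* sin t)%C| == 1.
Proof. by rewrite normc_def /= cos2Dsin2 sqrtr1. Qed.
Definition expi (t : R) : circle := Circle (expi_subproof t).

Lemma continuous_expi : continuous expi.
Proof.
apply/continuousP => _ [U oU <-]; rewrite -comp_preimage.
move: U oU; apply/continuousP => t /=.
have -> : val \o expi = (fun t => (cos t)%:C%C + 'i%C * (sin t)%:C%C).
  by apply/funext => x /=; rewrite [LHS]complexE.
apply: cvgD; first exact: cvg_comp (@continuous_cos R t) (@continuous_complex R _).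
by apply: cvgMr; exact: cvg_comp (@continuous_sin R t) (@continuous_complex R _).
Qed.

Fact measurable_expi :
  measurable_fun [set: R] (fun t : R => expi (2 * pi * t) : borel circle).
Proof.
apply: measurable_fun_borel => U oU; apply: open_measurable.
move: U oU; apply/continuousP => t.
apply: continuous_comp; last exact: continuous_expi.
exact: mulrl_continuous.
Qed.

(* Normalised arc length: the image of the uniform law on [0, 1] under
   t |-> exp (2 i pi t). *)
Definition circle_haar : set (borel circle) -> \bar R :=
  pushforward (uniform_prob (@ltr01 R))
    (fun t : R => expi (2 * pi * t) : borel circle).

Let circle_haar0 : circle_haar set0 = 0%E.
Proof. by rewrite /circle_haar /pushforward preimage_set0 measure0. Qed.

Let circle_haar_ge0 A : (0 <= circle_haar A)%E.
Proof. exact: (measure_ge0 (uniform_prob (@ltr01 R))). Qed.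

Let circle_haar_sigma_additive : semi_sigma_additive circle_haar.
Proof. exact: (@pushforward_semi_sigma_additive _ _ _ _ R (uniform_prob (@ltr01 R)) _ measurable_expi). Qed.

HB.instance Definition _ := isMeasure.Build _ _ _ circle_haar
  circle_haar0 circle_haar_ge0 circle_haar_sigma_additive.

Let circle_haar_setT : circle_haar setT = 1%E.
Proof. by rewrite /circle_haar /pushforward preimage_setT probability_setT. Qed.

HB.instance Definition _ :=
  Measure_isProbability.Build _ _ _ circle_haar circle_haar_setT.

End circle.

Definition homeomorphism_onto (X Y : topologicalType) (f : X -> Y) (B : set Y) :=
  continuous f /\ exists g : Y -> X,
    [/\ cancel f g, (forall x, B (f x)), (forall y, B y -> f (g y) = y)
      & {within B, continuous g}].

(* G carries no topology of its own: its discrete topology enters through the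
   continuity of twist_q into discrete_topology G. *)
Record twist (R : realType) (G : groupType) := Twist {
  twist_sort :> topologicalGroupType ;
  twist_i : circle R -> twist_sort ;
  twist_q : twist_sort -> G ;
  twist_locally_compact : locally_compact [set: twist_sort] ;
  twist_hausdorff : hausdorff_space twist_sort ;
  twist_iM : {morph twist_i : z w / (z * w)%g} ;
  twist_i_continuous : continuous twist_i ;
  twist_i_inj : injective twist_i ;
  twist_qM : {morph twist_q : x y / (x * y)%g} ;
  twist_q_continuous :
    continuous (twist_q : twist_sort -> discrete_topology G) ;
  twist_q_surj : forall a, exists x, twist_q x = a ;
  twist_exact : range twist_i = twist_q @^-1` [set 1%g] ;
  twist_central : forall z x, (twist_i z * x = x * twist_i z)%g ;
  twist_locally_trivial : forall a, exists2 P, twist_q P = a &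
    open (twist_q @^-1` [set a]) /\
    homeomorphism_onto (fun z => (twist_i z * P)%g) (twist_q @^-1` [set a])
}.

Definition cintegral d (T : measurableType d) (R : realType)
    (mu : {measure set T -> \bar R}) (f : T -> R[i]) : R[i] :=
  Complex (\int[mu]_x complex.Re (f x)) (\int[mu]_x complex.Im (f x)).

Section twisted_group_algebra.
Context (R : realType) (G : groupType) (E : twist R G).
Local Notation C := R[i].
Local Notation i := (@twist_i R G E).
Local Notation q := (@twist_q R G E).

Definition tact (z : circle R) (x : E) : E := (i z * x)%g.

(* An arbitrary point of the fibre over a; since Haar measure is translation
   invariant, fibre_measure does not depend on this choice. *)
Definition fibre_point (a : G) : E := get (q @^-1` [set a]).

Definition fibre_measure (a : G) : set (borel E) -> \bar R :=
  pushforward (@circle_haar R)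
    (fun z : borel (circle R) => tact z (fibre_point a) : borel E).

Definition twist_measure (A : set (borel E)) : \bar R :=
  (\esum_(a in [set: G]) fibre_measure a A)%E.

Fact measurable_tact (x : E) : measurable_fun [set: borel (circle R)]
  (fun z : borel (circle R) => tact z x : borel E).
Proof.
apply: (@continuous_measurable_borel (circle R) E) => z.
apply: (@continuous_comp _ _ _ (fun z => (i z, x)) (fun p : E * E => (p.1 * p.2)%g)).
  apply: cvg_pair; [exact: nbhs_filter|exact: (@twist_i_continuous _ _ E z)|].
  exact: (@cst_continuous (circle R) E x z).
exact: mulg_continuous.
Qed.

Let fibre_measure0 a : fibre_measure a set0 = 0%E.
Proof. by rewrite /fibre_measure /pushforward preimage_set0 measure0. Qed.

Let fibre_measure_ge0 a A : (0 <= fibre_measure a A)%E.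
Proof. exact: (measure_ge0 (@circle_haar R)). Qed.

Let fibre_measure_sigma_additive a : semi_sigma_additive (fibre_measure a).
Proof. exact: (@pushforward_semi_sigma_additive _ _ _ _ R (@circle_haar R) _ (measurable_tact _)). Qed.

HB.instance Definition _ a := isMeasure.Build _ _ _ (fibre_measure a)
  (fibre_measure0 a) (fibre_measure_ge0 a) (@fibre_measure_sigma_additive a).

Let twist_measure0 : twist_measure set0 = 0%E.
Proof. by apply: esum1 => a _; rewrite measure0. Qed.

Let twist_measure_ge0 A : (0 <= twist_measure A)%E.
Proof. by apply: esum_ge0 => a _; exact: measure_ge0. Qed.

Let twist_measure_sigma_additive : semi_sigma_additive twist_measure.
Proof.
move=> F mF tF mUF.
have -> : twist_measure (\bigcup_n F n) = (\sum_(n <oo) twist_measure (F n))%E.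
  rewrite nneseries_esumT; last by move=> n; exact: twist_measure_ge0.
  rewrite /twist_measure.
  under eq_esum => a _.
    rewrite measure_semi_bigcup//.
    rewrite nneseries_esumT; last by move=> n; exact: measure_ge0.
    over.
  rewrite esum_esum; last by move=> a n _ _; exact: measure_ge0.
  rewrite esum_esum; last by move=> n a _ _; exact: measure_ge0.
  rewrite (reindex_esum ([set: nat] `*`` fun=> [set: G]) _ (fun k => (k.2, k.1)))//.
  split=> //.
  - by move=> [a n] [b m] _ _ /= [-> ->].
  - by move=> [a n] _; exists (n, a).
exact: is_cvg_nneseries (fun n _ _ => twist_measure_ge0 (F n)).
Qed.

HB.instance Definition _ := isMeasure.Build _ _ _ twist_measure
  twist_measure0 twist_measure_ge0 twist_measure_sigma_additive.

(* Algebraic conditions on maps defined on (E -> C) are imposed below only at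
   elements of Sigma_c, so their values elsewhere are irrelevant. *)
Definition Sigma_c : set (E -> C) :=
  [set f | [/\ continuous f, compact (closure [set x | f x != 0])
             & forall z x, f (tact z x) = val z * f x]].

Definition twist_conv (f g : E -> C) : E -> C :=
  fun x => cintegral twist_measure (fun y : borel E => f (x * (y : E)^-1)%g * g y).

Definition invol (f : E -> C) : E -> C := fun x => (f x^-1%g)^*.

Definition delta (x : E) : E -> C := fun y =>
  if pselect (exists w, y = tact w x) is left yx then val (projT1 (cid yx)) else 0.

Lemma delta_tact x w : delta x (tact w x) = val w.
Proof.
rewrite /delta; case: pselect => [yx|[]]; last by exists w.
case: cid => v /= wv; congr circle_val.
by apply: (@twist_i_inj R G E); exact/esym/(mulIg _ _ _ wv).
Qed.

Lemma delta_out x y : (forall w, y <> tact w x) -> delta x y = 0.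
Proof. by move=> yx; rewrite /delta; case: pselect => // -[w yw]; case: (yx w). Qed.

End twisted_group_algebra.

(* The form is linear in its first variable. *)
Record hilbertType (R : realType) := Hilbert {
  hilbert_sort :> completeNormedModType R[i] ;
  inner : {dot hilbert_sort for Num.conj} ;
  hilbert_norm : forall x, `|x| ^+ 2 = inner x x
}.

Definition rnorm (R : realType) (V : normedModType R[i]) (x : V) : R :=
  complex.Re `|x|.

(* Operator norms and their supremum are taken in \bar R, so that no bound is
   presupposed. *)
Definition opnorm (R : realType) (V W : normedModType R[i]) (T : V -> W) : \bar R :=
  ereal_sup [set (rnorm (T x))%:E | x in [set x | rnorm x <= 1]].

Section full_norm.
Context (R : realType) (G : groupType) (E : twist R G).
Local Notation C := R[i].

Record is_star_rep (H : hilbertType R) (pi : (E -> C) -> {linear H -> H}) : Prop := {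
  star_rep_bounded : forall f, Sigma_c f -> continuous (pi f) ;
  star_repP : forall a f g, Sigma_c f -> Sigma_c g ->
    forall v, pi (fun x => a * f x + g x) v = a *: pi f v + pi g v ;
  star_repM : forall f g, Sigma_c f -> Sigma_c g ->
    forall v, pi (twist_conv f g) v = pi f (pi g v) ;
  star_rep_star : forall f, Sigma_c f ->
    forall v w, inner H (pi (invol f) v) w = inner H v (pi f w)
}.

Definition full_norm (f : E -> C) : \bar R :=
  ereal_sup [set r | exists (H : hilbertType R) (pi : (E -> C) -> {linear H -> H}),
    is_star_rep pi /\ r = opnorm (pi f)].

End full_norm.

(* Not necessarily unital, and possibly zero; the product is not the one of
   ssralg, whose algebras have 1 != 0. *)
HB.mixin Record isCStarAlgebra (R : realType) A & CompleteNormedModule R[i] A := {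
  cmul : A -> A -> A ;
  star : A -> A ;
  cmulA : associative cmul ;
  cmulDl : left_distributive cmul +%R ;
  cmulDr : right_distributive cmul +%R ;
  cmulZl : forall (a : R[i]) (x y : A), cmul (a *: x) y = a *: cmul x y ;
  cmulZr : forall (a : R[i]) (x y : A), cmul x (a *: y) = a *: cmul x y ;
  starK : involutive star ;
  starD : {morph star : x y / x + y} ;
  starZ : forall (a : R[i]) (x : A), star (a *: x) = a^* *: star x ;
  starM : forall x y : A, star (cmul x y) = cmul (star y) (star x) ;
  norm_cmul_le : forall x y : A, `|cmul x y| <= `|x| * `|y| ;
  norm_star_cmul : forall x : A, `|cmul (star x) x| = `|x| ^+ 2
}.

#[short(type="cstarAlgType")]
HB.structure Definition CStarAlgebra (R : realType) :=
  {A of isCStarAlgebra R A & CompleteNormedModule R[i] A}.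

HB.mixin Record CStarAlgebra_isUnital (R : realType) A & CStarAlgebra R A := {
  cone : A ;
  cmul1l : left_id cone (@cmul R A) ;
  cmul1r : right_id cone (@cmul R A)
}.

#[short(type="unitalCstarAlgType")]
HB.structure Definition UnitalCStarAlgebra (R : realType) :=
  {A of CStarAlgebra_isUnital R A & CStarAlgebra R A}.

Definition is_star_hom (R : realType) (A B : cstarAlgType R)
    (phi : {linear A -> B}) : Prop :=
  {morph phi : x y / cmul x y} /\ {morph phi : x / star x}.

Definition unitary (R : realType) (A : unitalCstarAlgType R) (u : A) : Prop :=
  cmul (star u) u = cone /\ cmul u (star u) = cone.

Section full_twisted_group_cstar_algebra.
Context (R : realType) (G : groupType) (E : twist R G).
Local Notation C := R[i].

(* The pair (B, j) is a completion of Sigma_c for full_norm, that is, a copy of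
   the full twisted group C*-algebra of E with its canonical map from Sigma_c. *)
Record is_full_completion (B : cstarAlgType R) (j : (E -> C) -> B) : Prop := {
  completionP : forall a f g, Sigma_c f -> Sigma_c g ->
    j (fun x => a * f x + g x) = a *: j f + j g ;
  completionM : forall f g, Sigma_c f -> Sigma_c g -> j (twist_conv f g) = cmul (j f) (j g) ;
  completion_star : forall f, Sigma_c f -> j (invol f) = star (j f) ;
  completion_isometric : forall f, Sigma_c f -> (rnorm (j f))%:E = full_norm f ;
  completion_dense : dense (j @` @Sigma_c R G E)
}.

End full_twisted_group_cstar_algebra.

(* Main.v *)
Require Import Defs.
From HB Require Import structures.
From mathcomp Require Import all_boot all_order all_algebra.
From mathcomp Require Import complex.
From mathcomp Require Import all_classical all_reals all_analysis.
From mathcomp Require Import finmap measurable_realfun ring lra.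

(* The map [f |-> sum_a f(x_a) t(x_a)], where [x_a] is any point of the fibre over
   [a], is a *-homomorphism from Sigma_c to [A]: a function in Sigma_c lives on
   finitely many fibres, and [f x *: t x] depends only on the fibre of [x], since
   the phases [z] and [z^*] cancel.  It sends [delta x] to [t x], and extends to
   the completion as soon as it is bounded by the full norm.  The full norm only
   sees representations on Hilbert spaces, so the bound is the Gelfand-Naimark
   theorem for [A]: every [a] in [A] is represented on some Hilbert space by an
   operator of norm at least [|a|].

   Call a selfadjoint [h] positive when [|c - h| <= c] for some [c].  Positive
   elements visibly form a convex cone, and have square roots by a convergent
   iteration.  If [v] and [w] are commuting selfadjoint elements with
   [v^2 + w^2 = c], then [(v + i w) / sqrt c] is unitary, so [|v|^2 <= c]; hence
   squares are positive and the norm is monotone on positive elements.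
   Kaplansky's argument then shows [x^* x] to be positive, the Hahn-Banach theorem
   gives a state [phi] with [phi (a^* a) = |a^* a|], and the GNS construction for
   [phi] gives the representation. *)

Set Implicit Arguments.
Unset Strict Implicit.
Unset Printing Implicit Defensive.

Import Order.TTheory GRing.Theory Num.Theory.
Import numFieldNormedType.Exports.

Local Open Scope classical_set_scope.
Local Open Scope ring_scope.

Local Notation "a %:* x" := (a%:C%C *: x) (at level 40, left associativity).

(** * Real-valued norms *)

Section rnorm_theory.
Context (R : realType) (V : normedModType R[i]).
Implicit Types (x y : V) (a : R[i]) (r : R).

Lemma rnormE x : `|x| = (rnorm x)%:C%C.
Proof. by rewrite RRe_real// normr_real. Qed.

Lemma rnorm_ge0 x : 0 <= rnorm x.
Proof. by rewrite -ler0c -rnormE. Qed.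

Lemma rnorm_le x r : (`|x| <= r%:C%C) = (rnorm x <= r).
Proof. by rewrite rnormE lecR. Qed.

Lemma rnorm_lt x r : (`|x| < r%:C%C) = (rnorm x < r).
Proof. by rewrite rnormE ltcR. Qed.

Lemma rnorm0 : rnorm (0 : V) = 0.
Proof. by rewrite /rnorm normr0. Qed.

Lemma rnorm_eq0 x : rnorm x = 0 -> x = 0.
Proof. by move=> x0; apply/normr0_eq0; rewrite rnormE x0. Qed.

Lemma rnormN x : rnorm (- x) = rnorm x.
Proof. by rewrite /rnorm normrN. Qed.

Lemma rdistC x y : rnorm (x - y) = rnorm (y - x).
Proof. by rewrite /rnorm distrC. Qed.

Lemma rnormD x y : rnorm (x + y) <= rnorm x + rnorm y.
Proof. by rewrite -lecR rmorphD /= -!rnormE ler_normD. Qed.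

Lemma rnormB x y : rnorm (x - y) <= rnorm x + rnorm y.
Proof. by rewrite -(rnormN y) rnormD. Qed.

Lemma rdistD x y z : rnorm (x - z) <= rnorm (x - y) + rnorm (y - z).
Proof. by rewrite (_ : x - z = (x - y) + (y - z)) ?rnormD// addrA subrK. Qed.

Lemma rnormZ a x : rnorm (a *: x) = complex.Re `|a| * rnorm x.
Proof. by rewrite {1}/rnorm normrZ rnormE normc_def /= mul0r subr0. Qed.

Lemma rnormZr r x : rnorm (r %:* x) = `|r| * rnorm x.
Proof. by rewrite rnormZ normc_def /= expr0n addr0 sqrtr_sqr. Qed.

Lemma rnorm_le_eps x y : (forall e, 0 < e -> rnorm (x - y) <= e) -> x = y.
Proof.
move=> xy; apply/eqP; rewrite -subr_eq0; apply/eqP/rnorm_eq0/eqP.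
rewrite eq_le rnorm_ge0 andbT; apply/ler_addgt0Pr => e e0.
by rewrite add0r xy.
Qed.

End rnorm_theory.

(** Completeness for sequences and real tolerances, which replaces filters and the complex-valued
    norm in the later estimates. *)
Lemma rnorm_complete (R : realType) (V : completeNormedModType R[i])
    (u : nat -> V) :
  (forall e : R, 0 < e -> exists N : nat, forall n m : nat,
     (N <= n)%N -> (N <= m)%N -> rnorm (u n - u m) <= e) ->
  exists l : V, forall e : R, 0 < e -> exists N : nat, forall n : nat,
     (N <= n)%N -> rnorm (u n - l) <= e.
Proof.
move=> cu.
have /cauchy_cvgP/cvg_ex[l ul] : cauchy (u @ \oo).
  apply: cauchy_exP => e e0.
  have er : e = (complex.Re e)%:C%C by rewrite RRe_real// gtr0_real.
  have er0 : 0 < complex.Re e by rewrite -ltcR -er.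
  have [N uN] := cu (complex.Re e / 2) (divr_gt0 er0 (ltr0Sn _ 1)).
  exists (u N); exists N => //= n Nn.
  rewrite -ball_normE /= er rnorm_lt (le_lt_trans (uN _ _ _ Nn))//.
  by rewrite ltr_pdivrMr// mulr_natr mulr2n ltrDl.
exists l => e e0.
have /cvgrPdist_lt/(_ e%:C%C) := ul; rewrite ltcR => /(_ e0)[N _ uN].
by exists N => n /uN; rewrite /= rnorm_lt rdistC => /ltW.
Qed.

(** [A] becomes a ring in which [1 = 0] is allowed, since a unital C*-algebra may be zero. *)
HB.instance Definition _ (R : realType) (A : unitalCstarAlgType R) :=
  GRing.Zmodule_isPzRing.Build A
    (@cmulA R A) (@cmul1l R A) (@cmul1r R A) (@cmulDl R A) (@cmulDr R A).
(** * Square roots in C*-algebras *)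

Section cstar_norm.
Context (R : realType) (B : cstarAlgType R).
Implicit Types x y : B.

Lemma star0 : star (0 : B) = 0.
Proof. by apply: (addrI (star 0)); rewrite -starD !addr0. Qed.

Lemma starN x : star (- x) = - star x.
Proof. by apply: (addrI (star x)); rewrite -starD !subrr star0. Qed.

Lemma starB x y : star (x - y) = star x - star y.
Proof. by rewrite starD starN. Qed.

Lemma rnorm_cmul x y : rnorm (cmul x y) <= rnorm x * rnorm y.
Proof. by rewrite -lecR rmorphM /= -!rnormE norm_cmul_le. Qed.

Lemma rnorm_star_cmul x : rnorm (cmul (star x) x) = rnorm x ^+ 2.
Proof. by apply: complexI; rewrite rmorphXn /= -!rnormE norm_star_cmul. Qed.

(** The C*-identity gives [|y|^2 <= |star y| |y|], hence [|y| <= |star y|]; this is applied to [x]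
    and to [star x]. *)
Lemma rnorm_star x : rnorm (star x) = rnorm x.
Proof.
have le_star y : rnorm y <= rnorm (star y).
  have [->|y0] := eqVneq (rnorm y) 0; first exact: rnorm_ge0.
  have := rnorm_cmul (star y) y; rewrite rnorm_star_cmul expr2 ler_pM2r//.
  by rewrite lt_neqAle eq_sym y0 rnorm_ge0.
by apply/eqP; rewrite eq_le le_star -{2}(starK x) le_star.
Qed.

Lemma rnorm_cmul_dist x y x' y' : rnorm (cmul x y - cmul x' y') <=
  rnorm x * rnorm (y - y') + rnorm (x - x') * rnorm y'.
Proof.
rewrite (_ : _ - _ = cmul x (y - y') + cmul (x - x') y'); last first.
  apply: (addIr (cmul x' y')); rewrite subrK -addrA -cmulDl subrK.
  by rewrite -cmulDr subrK.
by rewrite (le_trans (rnormD _ _))// lerD// rnorm_cmul.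
Qed.

End cstar_norm.

Section cstar.
Context (R : realType) (A : unitalCstarAlgType R).
Implicit Types (h k v w x y z : A) (c r : R).
Local Notation "c %:S" := (c%:C%C *: (1 : A)) (at level 1, format "c %:S").

Lemma scaleAl (a : R[i]) x y : a *: (x * y) = (a *: x) * y.
Proof. by symmetry; exact: cmulZl. Qed.

Lemma scaleAr (a : R[i]) x y : a *: (x * y) = x * (a *: y).
Proof. by symmetry; exact: cmulZr. Qed.

Lemma starMr x y : star (x * y) = star y * star x.
Proof. exact: starM. Qed.

Lemma star1 : star (1 : A) = 1.
Proof. by rewrite -[LHS]mulr1 -{2}(starK (1 : A)) -starMr mulr1 starK. Qed.

Lemma conj_realc r : (r%:C%C : R[i])^* = r%:C%C.
Proof. by rewrite conj_Creal// complex_real. Qed.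

Lemma conj_i : ('i%C : R[i])^* = - 'i%C.
Proof. by apply/eqP; rewrite eq_complex /= oppr0 !eqxx. Qed.

Lemma starZr r x : star (r %:* x) = r %:* star x.
Proof. by rewrite starZ conj_realc. Qed.

Lemma rnormM x y : rnorm (x * y) <= rnorm x * rnorm y.
Proof. exact: rnorm_cmul. Qed.

Lemma rnorm_star_mul x : rnorm (star x * x) = rnorm x ^+ 2.
Proof. exact: rnorm_star_cmul. Qed.

Lemma rnorm_mul_star x : rnorm (x * star x) = rnorm x ^+ 2.
Proof. by rewrite -{1}(starK x) rnorm_star_mul rnorm_star. Qed.

Lemma rnorm_sqr h : star h = h -> rnorm (h * h) = rnorm h ^+ 2.
Proof. by move=> hs; rewrite -{1}hs rnorm_star_mul. Qed.

(** Since [1] is selfadjoint and idempotent, its norm [n] satisfies [n = n^2]; in the zero algebra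
    [n = 0]. *)
Lemma rnorm1_le : rnorm (1 : A) <= 1.
Proof.
have := rnorm_sqr star1; rewrite mulr1.
by have := rnorm_ge0 (1 : A); nra.
Qed.

Lemma rnorm_scalar c : 0 <= c -> rnorm (c%:S) <= c.
Proof. by move=> c0; rewrite rnormZr ger0_norm// ler_piMr// rnorm1_le. Qed.

Lemma star_scalar c : star (c%:S) = c%:S.
Proof. by rewrite starZr star1. Qed.

Lemma comm_scalar c x : GRing.comm x c%:S.
Proof. by rewrite /GRing.comm -scaleAl -scaleAr mul1r mulr1. Qed.

(* With u := v + i w one has u^* u = v^2 + w^2 and v = (u + u^* ) / 2. *)
Lemma rnorm_sum_sqr v w c : star v = v -> star w = w -> GRing.comm v w ->
  0 <= c -> v * v + w * w = c%:S -> rnorm v ^+ 2 <= c.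
Proof.
move=> vs ws vw c0 vwc.
have su : star (v + 'i%C *: w) = v - 'i%C *: w.
  by rewrite starD starZ vs ws conj_i scaleNr.
have uu : star (v + 'i%C *: w) * (v + 'i%C *: w) = c%:S.
  rewrite su mulrBl !mulrDr -!scaleAl -!scaleAr scalerA -(expr2 'i%C) sqr_i.
  by rewrite scaleN1r opprD opprK -vwc (vw : v * w = w * v) addrA addrK.
have u2 : rnorm (v + 'i%C *: w) ^+ 2 <= c.
  by rewrite -rnorm_star_mul uu rnorm_scalar.
have v2 : 2 * rnorm v <= 2 * rnorm (v + 'i%C *: w).
  rewrite -{1}(ger0_norm (ler0n R 2)) -rnormZr.
  rewrite (_ : 2 %:* v = (v + 'i%C *: w) + star (v + 'i%C *: w)); last first.
    by rewrite su addrACA subrr addr0 rmorph_nat scaler_nat mulr2n.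
  by rewrite mulrDl mul1r (le_trans (rnormD _ _))// rnorm_star.
by have := rnorm_ge0 v; nra.
Qed.

Section sqrt.
Variable k : A.
Hypotheses (ks : star k = k) (k1 : rnorm k <= 1).

(* The solution [1 - sqrt (1 - k)] of [y = (k + y^2) / 2] by iteration; the real
   sequence, which is the case [k = 1], majorises the increments. *)
Fixpoint sqrt_iter n : A :=
  if n is m.+1 then 2^-1 %:* (k + sqrt_iter m * sqrt_iter m) else 0.

Fixpoint sqrt_iterR n : R :=
  if n is m.+1 then 2^-1 * (1 + sqrt_iterR m ^+ 2) else 0.

Lemma sqrt_iterS n :
  sqrt_iter n.+1 = 2^-1 %:* (k + sqrt_iter n * sqrt_iter n).
Proof. by []. Qed.

Lemma sqrt_iterRS n : sqrt_iterR n.+1 = 2^-1 * (1 + sqrt_iterR n ^+ 2).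
Proof. by []. Qed.

Lemma sqrt_iterR_bound n : 0 <= sqrt_iterR n <= 1.
Proof. by elim: n => /= [|n]; [rewrite lexx ler01|nra]. Qed.

Lemma sqrt_iterR_le n m : (n <= m)%N -> sqrt_iterR n <= sqrt_iterR m.
Proof.
move=> /subnKC <-; elim: (m - n)%N => [|i ih]; first by rewrite addn0.
rewrite addnS (le_trans ih)//=; have := sqrt_iterR_bound (n + i)%N.
by move: (sqrt_iterR _) => c; nra.
Qed.

(** The iterates are polynomials in [k]. *)
Lemma comm_sqrt_iter z n : GRing.comm z k -> GRing.comm z (sqrt_iter n).
Proof.
move=> zk; elim: n => /= [|n ih]; first exact: commr0.
rewrite /GRing.comm -scaleAr -scaleAl; congr (_ *: _).
by apply: commrD => //; exact: commrM.
Qed.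

Lemma rnorm_sqrt_iter n : rnorm (sqrt_iter n) <= sqrt_iterR n.
Proof.
elim: n => /= [|n ih]; first by rewrite rnorm0.
rewrite rnormZr ger0_norm ?invr_ge0// ler_pM2l ?invr_gt0//.
rewrite (le_trans (rnormD _ _))// lerD// (le_trans (rnormM _ _))// expr2.
by rewrite ler_pM// rnorm_ge0.
Qed.

Lemma sqrt_iter_step n :
  rnorm (sqrt_iter n.+1 - sqrt_iter n) <= sqrt_iterR n.+1 - sqrt_iterR n.
Proof.
elim: n => [|n ih].
  rewrite /= mulr0 !subr0 addr0 expr0n addr0 rnormZr ger0_norm ?invr_ge0//.
  by rewrite ler_pM2l ?invr_gt0.
rewrite (sqrt_iterS n.+1) {3}(sqrt_iterS n) -scalerBr.
(* Consecutive iterates commute, so the difference of their squares factors; the same factorisation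
   of the real sequence bounds it factor by factor. *)
rewrite (_ : _ - _ = (sqrt_iter n.+1 - sqrt_iter n) *
                     (sqrt_iter n.+1 + sqrt_iter n)); last first.
  rewrite opprD addrACA subrr add0r mulrBl !mulrDr opprD addrA.
  rewrite (_ : sqrt_iter n.+1 * sqrt_iter n = sqrt_iter n * sqrt_iter n.+1).
    by rewrite addrK.
  by apply: comm_sqrt_iter; apply/commr_sym/comm_sqrt_iter.
rewrite (sqrt_iterRS n.+1) {2}(sqrt_iterRS n) -mulrBr.
rewrite rnormZr ger0_norm ?invr_ge0// ler_pM2l ?invr_gt0//.
rewrite (_ : _ - _ = (sqrt_iterR n.+1 - sqrt_iterR n) *
                     (sqrt_iterR n.+1 + sqrt_iterR n)); last by ring.
rewrite (le_trans (rnormM _ _))// ler_pM// ?rnorm_ge0//.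
by rewrite (le_trans (rnormD _ _))// lerD// rnorm_sqrt_iter.
Qed.

Lemma sqrt_iter_dist n m : (n <= m)%N ->
  rnorm (sqrt_iter m - sqrt_iter n) <= sqrt_iterR m - sqrt_iterR n.
Proof.
move=> /subnKC <-; elim: (m - n)%N => [|i ih].
  by rewrite addn0 !subrr rnorm0.
rewrite addnS (le_trans (rdistD _ (sqrt_iter (n + i)) _))//.
have := lerD (sqrt_iter_step (n + i)) ih.
by rewrite addrA subrK.
Qed.

(** The real majorant is nondecreasing and bounded by 1, hence Cauchy, and its increments dominate
    those in [A]. *)
Lemma sqrt_iter_cvg : exists l : A, forall e : R, 0 < e ->
  exists N : nat, forall n : nat, (N <= n)%N -> rnorm (sqrt_iter n - l) <= e.
Proof.
apply: rnorm_complete => e e0.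
have /cvg_cauchy : cvgn sqrt_iterR.
  apply: nondecreasing_is_cvgn; first by move=> n m; exact: sqrt_iterR_le.
  by exists 1 => _ [n _ <-]; case/andP: (sqrt_iterR_bound n).
move=> /cauchy_ballP/(_ _ e0)[[P Q]/= [[N1 _ PN] [N2 _ QN]] PQ].
exists (maxn N1 N2) => n m; rewrite !geq_max => /andP[n1 n2] /andP[m1 m2].
have nm : `|sqrt_iterR n - sqrt_iterR m| < e.
  by apply: (PQ (_, _)); split; [exact: PN|exact: QN].
case/orP: (leq_total n m) => /sqrt_iter_dist nm1.
  by rewrite rdistC (le_trans nm1)// (le_trans (ler_norm _))// distrC ltW.
by rewrite (le_trans nm1)// (le_trans (ler_norm _))// ltW.
Qed.

(** The root is [w = 1 - l] with [l] the limit of the iteration: [2 l = k + l^2] amounts to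
    [(1 - l)^2 = 1 - k]. The bound on [1 - w = l] is what makes [w] positive. *)
Lemma sqrt_one_sub : exists2 w : A, star w = w /\ w * w = 1 - k &
  rnorm (1 - w) <= 1 /\ forall z, GRing.comm z k -> GRing.comm z w.
Proof.
have [l ul] := sqrt_iter_cvg.
have us n : star (sqrt_iter n) = sqrt_iter n.
  by elim: n => [|n ih] /=; rewrite ?star0// starZr starD starMr ih ks.
have ls : star l = l.
  apply: rnorm_le_eps => e e0.
  have [N /(_ _ (leqnn N)) uN] := ul _ (divr_gt0 e0 (ltr0Sn _ 1)).
  rewrite (le_trans (rdistD _ (sqrt_iter N) _))// (splitr e) lerD//.
  by rewrite -us -starB rnorm_star rdistC.
have l1 : rnorm l <= 1.
  apply/ler_addgt0Pr => e e0; have [N /(_ _ (leqnn N)) uN] := ul _ e0.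
  rewrite -(subrK (sqrt_iter N) l) (le_trans (rnormD _ _))// addrC rdistC lerD//.
  by rewrite (le_trans (rnorm_sqrt_iter _))//; case/andP: (sqrt_iterR_bound N).
have lk z : GRing.comm z k -> GRing.comm z l.
  move=> zk; apply: rnorm_le_eps => e e0.
  (* The commutator of [z] and [l] splits into two terms of norm at most [|z| |u_N - l|]; the [+ 1]
     keeps the divisor nonzero. *)
  have z0 : 0 < 2 * (rnorm z + 1) by have := rnorm_ge0 z; nra.
  have [N /(_ _ (leqnn N)) uN] := ul _ (divr_gt0 e0 z0).
  rewrite (_ : _ - _ = (sqrt_iter N - l) * z - z * (sqrt_iter N - l)); last first.
    rewrite mulrBr mulrBl (comm_sqrt_iter N zk : z * _ = _).
    by rewrite opprB [RHS]addrC addrA subrK.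
  rewrite (le_trans (rnormB _ _))//.
  have := rnormM (sqrt_iter N - l) z; have := rnormM z (sqrt_iter N - l).
  have : 2 * (rnorm z + 1) * rnorm (sqrt_iter N - l) <= e.
    by rewrite mulrC -ler_pdivlMr.
  by have := rnorm_ge0 z; have := rnorm_ge0 (sqrt_iter N - l); nra.
have ll : 2 %:* l = k + l * l.
  apply: rnorm_le_eps => e e0.
  (* The error is at most [2 |u_(N+1) - l| + (|u_N| + |l|) |u_N - l|], where [|u_N|] and [|l|] are
     at most 1: four quarters of [e]. *)
  have e4 : 0 < e / 4 by rewrite divr_gt0.
  have [N uN] := ul _ e4.
  have u1 := uN _ (leqnSn N); have u0 := uN _ (leqnn N).
  have -> : 2 %:* l - (k + l * l) = 2 %:* (l - sqrt_iter N.+1) +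
      ((sqrt_iter N - l) * sqrt_iter N + l * (sqrt_iter N - l)).
    have -> : (sqrt_iter N - l) * sqrt_iter N + l * (sqrt_iter N - l) =
              sqrt_iter N * sqrt_iter N - l * l.
      by rewrite mulrBl mulrBr addrA subrK.
    have u2 : 2 %:* sqrt_iter N.+1 = k + sqrt_iter N * sqrt_iter N.
      by rewrite sqrt_iterS scalerA -rmorphM mulfV ?pnatr_eq0// scale1r.
    by rewrite scalerBr u2 !opprD !addrA subrK.
  have := rnormM (sqrt_iter N - l) (sqrt_iter N).
  have := rnormM l (sqrt_iter N - l).
  have := rnormD ((sqrt_iter N - l) * sqrt_iter N) (l * (sqrt_iter N - l)).
  have := rnormD (2 %:* (l - sqrt_iter N.+1))
    ((sqrt_iter N - l) * sqrt_iter N + l * (sqrt_iter N - l)).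
  rewrite (rnormZr 2) ger0_norm// (rdistC l).
  have uN1 : rnorm (sqrt_iter N) <= 1.
    by rewrite (le_trans (rnorm_sqrt_iter _))//; case/andP: (sqrt_iterR_bound N).
  have := rnorm_ge0 (sqrt_iter N - l); have := rnorm_ge0 (sqrt_iter N).
  have := rnorm_ge0 l.
  by nra.
exists (1 - l); last first.
  rewrite opprB addrC subrK; split=> // z zk.
  by apply: commrB; [exact: commr1|exact: lk].
split; first by rewrite starB star1 ls.
have -> : (1 - l) * (1 - l) = 1 - 2 %:* l + l * l.
  rewrite mulrBr mulr1 mulrBl mul1r rmorph_nat scaler_nat mulr2n.
  by rewrite opprB opprD [in RHS]addrA addrA [in RHS]addrAC.
by rewrite ll opprD [in LHS]addrA subrK.
Qed.
End sqrt.

End cstar.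

(** * Positive elements *)

Section positive.
Context (R : realType) (A : unitalCstarAlgType R).
Implicit Types (h k v w x y z : A) (c r : R).
Local Notation "c %:S" := (c%:C%C *: (1 : A)) (at level 1, format "c %:S").

(* For selfadjoint [h] this says that the spectrum of [h] lies in [0, 2c]. *)
Definition positive h := star h = h /\ exists c, rnorm (c%:S - h) <= c.

Lemma scalarM c x : c%:S * x = c %:* x.
Proof. by rewrite -scaleAl mul1r. Qed.

Lemma scaleZr c r x : c %:* (r %:* x) = (c * r) %:* x.
Proof. by rewrite scalerA -rmorphM. Qed.

Lemma scalarD c r : (c + r)%:S = c%:S + r%:S.
Proof. by rewrite rmorphD scalerDl. Qed.

Lemma scalarB c r : (c - r)%:S = c%:S - r%:S.
Proof. by rewrite rmorphB scalerBl. Qed.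

Lemma scaleMM c r x y : (c %:* x) * (r %:* y) = (c * r) %:* (x * y).
Proof. by rewrite -scaleAl -scaleAr scaleZr. Qed.

Lemma comm_scale r x y : GRing.comm x y -> GRing.comm x (r %:* y).
Proof. by rewrite /GRing.comm -scaleAl -scaleAr => ->. Qed.

Lemma positive_star h : positive h -> star h = h.
Proof. by case. Qed.

Lemma rnorm_sub_le h c r : c <= r -> rnorm (c%:S - h) <= c ->
  rnorm (r%:S - h) <= r.
Proof.
move=> cr hc; have -> : r%:S - h = (r - c)%:S + (c%:S - h).
  by rewrite scalarB addrA subrK.
rewrite (le_trans (rnormD _ _))// -[leRHS](subrK c) lerD//.
by rewrite rnorm_scalar// subr_ge0.
Qed.

Lemma positiveD h k : positive h -> positive k -> positive (h + k).
Proof.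
move=> [hs [c hc]] [ks [r kr]]; split; first by rewrite starD hs ks.
exists (c + r); rewrite scalarD opprD addrACA.
by rewrite (le_trans (rnormD _ _))// lerD.
Qed.

Lemma positiveZ r h : 0 <= r -> positive h -> positive (r %:* h).
Proof.
move=> r0 [hs [c hc]]; split; first by rewrite starZr hs.
by exists (r * c); rewrite -scaleZr -scalerBr rnormZr ger0_norm// ler_wpM2l.
Qed.

Lemma positive_scalar c : 0 <= c -> positive c%:S.
Proof.
by move=> c0; split; [exact: star_scalar|exists c; rewrite subrr rnorm0].
Qed.

Lemma sqr_eq0 h : star h = h -> h * h = 0 -> h = 0.
Proof.
move=> hs hh; apply: rnorm_eq0; apply/eqP.
by have /eqP := rnorm_sqr hs; rewrite hh rnorm0 eq_sym expf_eq0.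
Qed.

Lemma positive_sqrt h : positive h -> exists w,
  [/\ star w = w, w * w = h, positive w &
      forall z, GRing.comm z h -> GRing.comm z w].
Proof.
(* With [k = 1 - h / c] one has [h = c (1 - k)]; the constant is raised by 1 because [c0] may be 0
   and [c] is divided by. *)
move=> [hs [c0 hc0]]; pose c := c0 + 1.
have c00 : 0 <= c0 by rewrite (le_trans _ hc0)// rnorm_ge0.
have c_gt0 : 0 < c by rewrite ltr_wpDl.
have hc : rnorm (c%:S - h) <= c by apply: rnorm_sub_le hc0; rewrite lerDl.
pose k := c^-1 %:* (c%:S - h).
have ks : star k = k by rewrite starZr starB hs star_scalar.
have k1 : rnorm k <= 1.
  by rewrite rnormZr gtr0_norm ?invr_gt0// ler_pdivrMl// mulr1.
have [w [ws ww] [w1 wk]] := sqrt_one_sub ks k1.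
have ch : c %:* (1 - k) = h.
  rewrite scalerBr scaleZr mulfV ?gt_eqF// scale1r opprB addrC.
  by rewrite subrK.
exists (Num.sqrt c %:* w); split.
- by rewrite starZr ws.
- by rewrite scaleMM -expr2 sqr_sqrtr ?ltW// ww.
- apply: positiveZ; first exact: sqrtr_ge0.
  by split=> //; exists 1; rewrite scale1r.
- move=> z zh; apply: comm_scale; apply: wk; apply: comm_scale.
  by apply: commrB => //; exact: comm_scalar.
Qed.

(* [y / sqrt c] and the square root of [1 - y^2 / c] are the real and imaginary
   parts of a unitary. *)
Lemma rnorm_sub_sqr y c : star y = y -> 0 < c -> rnorm y ^+ 2 <= c ->
  rnorm (c%:S - y * y) <= c.
Proof.
move=> ys c0 yc; pose k := c^-1 %:* (y * y).
have ks : star k = k by rewrite starZr starMr ys.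
have k1 : rnorm k <= 1.
  rewrite rnormZr gtr0_norm ?invr_gt0// ler_pdivrMl// mulr1.
  by rewrite rnorm_sqr.
have [w [ws ww] [_ wk]] := sqrt_one_sub ks k1.
have yw : GRing.comm y w.
  by apply: wk; apply: comm_scale; exact: commrM.
have sc : (Num.sqrt c^-1) ^+ 2 = c^-1 by rewrite sqr_sqrtr// invr_ge0 ltW.
have w1 : rnorm w ^+ 2 <= 1.
  apply: (@rnorm_sum_sqr _ _ w (Num.sqrt c^-1 %:* y)) => //.
  - by rewrite starZr ys.
  - by apply: comm_scale; exact: commr_sym.
  - by rewrite scaleMM -(expr2 (Num.sqrt _)) sc ww subrK scale1r.
have -> : c%:S - y * y = c %:* (w * w).
  by rewrite ww scalerBr scaleZr mulfV ?gt_eqF// scale1r.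
by rewrite rnormZr gtr0_norm// ler_piMr ?rnorm_sqr// ltW.
Qed.

Lemma positive_sqr y : star y = y -> positive (y * y).
Proof.
move=> ys; split; first by rewrite starMr ys.
exists (rnorm y ^+ 2 + 1); apply: rnorm_sub_sqr => //.
  by rewrite ltr_wpDl ?sqr_ge0.
by rewrite lerDl.
Qed.

(** The definition of [positive] provides some constant; writing [h] as a square shows that every
    constant at least [|h|] will do. *)
Lemma rnorm_sub_positive h c : positive h -> rnorm h <= c ->
  rnorm (c%:S - h) <= c.
Proof.
move=> /positive_sqrt[w [ws <- _ _]]; rewrite rnorm_sqr// => wc.
have := le_trans (sqr_ge0 _) wc; rewrite le_eqVlt => /predU1P[c0|c0]; last first.
  exact: rnorm_sub_sqr.
rewrite -c0 scale0r sub0r rnormN rnorm_sqr//.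
by rewrite -c0 in wc.
Qed.

Lemma positive_sub h c : positive h -> rnorm h <= c -> positive (c%:S - h).
Proof.
move=> hp hc; split; first by rewrite starB star_scalar positive_star.
by exists c; rewrite opprB addrC subrK.
Qed.

(** The square roots [w] of [h] and [v] of [c - h] commute and satisfy [w^2 + v^2 = c], so
    [rnorm_sum_sqr] bounds [|w|^2 = |h|]. *)
Lemma positive_le_scalar h c : 0 <= c -> positive h -> positive (c%:S - h) ->
  rnorm h <= c.
Proof.
move=> c0 hp kp; have [w [ws wh _ _]] := positive_sqrt hp.
have [v [vs vk _ vc]] := positive_sqrt kp.
rewrite -wh rnorm_sqr//; apply: (@rnorm_sum_sqr _ _ w v) => //.
  apply: vc; apply: commrB; first exact: comm_scalar.
  by rewrite -wh; exact: commrM.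
by rewrite vk wh addrC subrK.
Qed.

(** [|k| - h] is the sum of the positive elements [|k| - k] and [k - h]. *)
Lemma rnorm_positive_le h k : positive h -> positive (k - h) ->
  rnorm h <= rnorm k.
Proof.
move=> hp khp; apply: positive_le_scalar => //; first exact: rnorm_ge0.
have kp : positive k by rewrite -(subrK h k); exact: positiveD.
have -> : (rnorm k)%:S - h = ((rnorm k)%:S - k) + (k - h).
  by rewrite addrA subrK.
by apply: positiveD => //; exact: positive_sub.
Qed.

Lemma positive_anti h : positive h -> positive (- h) -> h = 0.
Proof.
move=> hp nhp; apply: rnorm_eq0; apply/eqP; rewrite eq_le rnorm_ge0 andbT.
by apply: positive_le_scalar => //; rewrite scale0r sub0r.
Qed.

Lemma i_star y : star ('i%C *: (y - star y)) = 'i%C *: (y - star y).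
Proof.
by rewrite starZ starB starK -(opprB y) scalerN -scaleNr conj_i opprK.
Qed.

(** For [y = a + i b] with [a], [b] selfadjoint, this is [y (star y) + (star y) y = 2 (a^2 + b^2)];
    the two squares are those of [2 a] and [- 2 b]. *)
Lemma star_mul_sum y : 2 %:* (y * star y) =
  (y + star y) * (y + star y) +
  ('i%C *: (y - star y)) * ('i%C *: (y - star y)) + 2 %:* (- (star y * y)).
Proof.
rewrite -scaleAl -scaleAr scalerA -(expr2 'i%C) sqr_i scaleN1r.
rewrite -[in LHS](addrK (2 %:* (star y * y)) (2 %:* (y * star y))) scalerN.
congr (_ + _).
rewrite !mulrDl !mulrDr !mulrN !mulNr opprK !opprD opprK.
rewrite !rmorph_nat !scaler_nat !mulr2n.
by rewrite opprK [RHS]addrACA; congr (_ + _); rewrite addrACA subrr ?add0r ?addr0.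
Qed.

(* With [p := - y^* y >= 0], [s := y y^* >= 0] and [N := |y|^2], the equality
   [(1 + s / N) y = y (1 - p / N)] compares an expansion with a contraction. *)
Lemma neg_star_mul y : positive (- (star y * y)) -> y = 0.
Proof.
move=> pp; pose p := - (star y * y); pose s := y * star y.
have sp : positive s.
  have -> : s = 2^-1 %:* (2 %:* s).
    by rewrite scaleZr mulVf ?pnatr_eq0// scale1r.
  apply: positiveZ; first by rewrite invr_ge0.
  rewrite star_mul_sum; apply: positiveD; last exact: positiveZ.
  apply: positiveD; apply: positive_sqr; last exact: i_star.
  by rewrite starD starK addrC.
have ss := positive_star sp.
pose N := rnorm y ^+ 2.
have [y0|N0] := eqVneq (rnorm y) 0; first exact: rnorm_eq0.
have {}N0 : 0 < N by rewrite exprn_even_gt0.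
pose S := (1 : A) + N^-1 %:* s; pose T := (1 : A) - N^-1 %:* p.
have yT : S * y = y * T.
  rewrite /S /T /p mulrDl mul1r mulrBr mulr1 scalerN mulrN opprK.
  by rewrite -scaleAl -scaleAr /s mulrA.
(* [p / N] is positive of norm 1, so [1 - p / N] is a contraction. *)
have T1 : rnorm T <= 1.
  rewrite /T -[X in X - _]scale1r; apply: rnorm_sub_positive.
    by apply: positiveZ => //; rewrite invr_ge0 ltW.
  rewrite rnormZr gtr0_norm ?invr_gt0// /p rnormN rnorm_star_mul.
  by rewrite mulVf ?gt_eqF.
have yTN : rnorm (S * y) ^+ 2 <= N.
  rewrite yT ler_pXn2r ?nnegrE ?rnorm_ge0//.
  by rewrite (le_trans (rnormM _ _))// ler_piMr// rnorm_ge0.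
have SsS : rnorm (S * y) ^+ 2 = rnorm (S * s * S).
  have Ss : star S = S by rewrite starD star1 starZr ss.
  by rewrite -rnorm_mul_star starMr Ss /s !mulrA.
have sN : rnorm ((2 * N^-1) %:* (s * s)) = 2 * N.
  rewrite rnormZr ger0_norm ?mulr_ge0// ?invr_ge0 ?ltW// rnorm_sqr//.
  by rewrite /s rnorm_mul_star -/N expr2 -mulrA [_ * (N * N)]mulKf ?gt_eqF.
have [w [ws wws _ wc]] := positive_sqrt sp.
have sw : GRing.comm s w by exact: wc.
(* [|S y|^2 = |S s S|] is at most [N], yet [S s S] dominates [(2 / N) s^2], of norm [2 N]. *)
suff : 2 * N <= N by rewrite mulr_natl mulr2n gerDl leNgt N0.
rewrite -{1}sN (le_trans _ yTN)// SsS.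
apply: rnorm_positive_le.
  apply: positiveZ; first by rewrite mulr_ge0// invr_ge0 ltW.
  exact: positive_sqr.
(* The difference is [s + s^3 / N^2], and [s^3 = (s w)^2] with [w] the square root of [s]. *)
have -> : S * s * S - (2 * N^-1) %:* (s * s) =
    s + (N^-1 * N^-1) %:* ((s * w) * (s * w)).
  have -> : (s * w) * (s * w) = s * s * s.
    by rewrite mulrA -(mulrA s w s) -(sw : s * w = w * s) mulrA -(mulrA (s * s)) wws.
  rewrite !mulrDl !mulrDr !mul1r !mulr1 -!scaleAl -!scaleAr !scaleZr.
  by rewrite rmorphD scalerDl [X in _ + X - _]addrC addrACA addrK.

apply: positiveD => //; apply: positiveZ.
  by rewrite mulr_ge0// invr_ge0 ltW.
by apply: positive_sqr; rewrite starMr ws ss sw.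
Qed.

(* For [m := |h| - h], where [h := x^* x], [(x m)^* (x m) = - m |h| m]. *)
Lemma positive_star_mul x : positive (star x * x).
Proof.
pose h := star x * x; rewrite -/h.
have hs : star h = h by rewrite starMr starK.
have [r [rs rr rp rc]] := positive_sqrt (positive_sqr hs).
have hr : GRing.comm h r by apply: rc; exact: commrM.
pose m := r - h.
have ms : star m = m by rewrite starB rs hs.
have mh : m * h = - (r * m).
  by rewrite mulrBl mulrBr opprB rr.
have rm : GRing.comm m r.
  by apply/commr_sym; apply: commrB => //; exact: commr_sym.
have mrm : star (x * m) * (x * m) = - (m * r * m).
  by rewrite starMr ms mulrA -(mulrA m) -/h mh mulNr (rm : m * r = r * m).
have [v [vs vr vp vc]] := positive_sqrt rp.
have vm : GRing.comm m v by exact: vc.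
(* With [|h| = v^2], the element [m |h| m = (m v)^2] is positive, so [neg_star_mul] applies to
   [x m]. *)
have xm0 : x * m = 0.
  apply: neg_star_mul; rewrite mrm opprK -vr.
  rewrite (_ : m * (v * v) * m = (m * v) * (m * v)); last first.
    by rewrite -!mulrA (vm : m * v = v * m).
  by apply: positive_sqr; rewrite starMr vs ms vm.
have mhm : m * h * m = 0 by rewrite /h mulrA -mulrA xm0 mulr0.
have mrm0 : m * r * m = 0.
  by apply/eqP; rewrite -oppr_eq0 -mrm xm0 mulr0.
have m3 : m * m * m = 0.
  have -> : m * m * m = m * r * m - m * h * m by rewrite -mulrBl -mulrBr.
  by rewrite mrm0 mhm subr0.
(* [m^3 = 0] gives [(m^2)^2 = 0]; the C*-identity, used twice, then yields [m = 0], that is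
   [h = |h|]. *)
have m0 : m = 0.
  apply: sqr_eq0 => //; apply: sqr_eq0; first by rewrite starMr ms.
  by rewrite mulrA m3 mul0r.
by have -> : h = r by apply/eqP; rewrite eq_sym -subr_eq0; exact/eqP.
Qed.

End positive.

(** * The Hahn-Banach theorem *)

Section sublinear.
Context (R : realType) (V : lmodType R).
Implicit Types (p q : V -> R) (b x y : V) (r s t : R).

Definition sublinear q :=
  (forall x y, q (x + y) <= q x + q y) /\
  (forall r x, 0 <= r -> q (r *: x) = r * q x).

(** The reverse inequality is the given one for [r^-1] at [r *: x]. *)
Lemma sublinear_homo q : (forall r x, 0 < r -> q (r *: x) <= r * q x) ->
  q 0 = 0 -> forall r x, 0 <= r -> q (r *: x) = r * q x.
Proof.
move=> qr q0 r x; rewrite le_eqVlt => /predU1P[<-|r0]; first by rewrite scale0r mul0r.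
apply/eqP; rewrite eq_le qr//= -ler_pdivlMl//.
have := qr r^-1 (r *: x); rewrite invr_gt0 scalerA mulVf ?gt_eqF// scale1r.
exact.
Qed.

Lemma sublinear0 q : sublinear q -> q 0 = 0.
Proof. by move=> [_ /(_ 0 0 (lexx 0))]; rewrite scale0r mul0r. Qed.

Lemma sublinear_lb q x : sublinear q -> - q (- x) <= q x.
Proof.
by move=> sq; rewrite -subr_ge0 opprK -(sublinear0 sq) -(subrr x) (sq.1 x).
Qed.

Section tilt.
Context q b (sq : sublinear q).

Let D x := [set q (x + t *: b) - t * q b | t in [set t | 0 <= t]].

(** The largest sublinear functional below [q] whose value at [- b] is at most [- q b]. *)
Definition tilt x := inf (D x).

Let D_lb x : lbound (D x) (- q (- x)).
Proof.
move=> _ [t /= t0 <-]; rewrite -sq.2// lerBrDl lerBlDr.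
by have := sq.1 (x + t *: b) (- x); rewrite addrAC subrr add0r.
Qed.

Let D_inf x : has_inf (D x).
Proof.
split; last by exists (- q (- x)); exact: D_lb.
by exists (q (x + 0 *: b) - 0 * q b); exists 0 => /=.
Qed.

Let tilt_le x t : 0 <= t -> tilt x <= q (x + t *: b) - t * q b.
Proof. by move=> t0; apply: ge_inf; [exact: (D_inf x).2|exists t]. Qed.

Lemma le_tilt x : tilt x <= q x.
Proof. by have := tilt_le x (lexx 0); rewrite scale0r mul0r addr0 subr0. Qed.

Lemma tilt_opp : tilt (- b) <= - q b.
Proof.
by have := tilt_le (- b) ler01; rewrite scale1r mul1r addNr sublinear0// sub0r.
Qed.

Lemma sublinear_tilt : sublinear tilt.
Proof.
split=> [x y|].
  rewrite -lerBlDr; apply: lb_le_inf; first exact: (D_inf x).1.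
  move=> _ [t /= t0 <-]; rewrite lerBlDr -lerBlDl.
  apply: lb_le_inf; first exact: (D_inf y).1.
  move=> _ [s /= s0 <-]; rewrite lerBlDl.
  rewrite (le_trans (tilt_le _ (addr_ge0 t0 s0)))// scalerDl addrACA.
  have := sq.1 (x + t *: b) (y + s *: b); lra.
apply: sublinear_homo => [r x r0|].
  rewrite -ler_pdivrMl//; apply: lb_le_inf; first exact: (D_inf x).1.
  move=> _ [t /= t0 <-]; rewrite ler_pdivrMl// mulrBr -(sq.2 r (x + _) (ltW r0)) mulrA.
  by rewrite scalerDr scalerA; apply: tilt_le; rewrite mulr_ge0// ltW.
apply/eqP; rewrite eq_le -{1}(sublinear0 sq) le_tilt /=.
apply: lb_le_inf; first exact: (D_inf 0).1.
by move=> _ [t /= t0 <-]; rewrite add0r sq.2// subrr.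
Qed.

End tilt.

(** Zorn's lemma for the reversed pointwise order. The pointwise infimum of a nonempty chain is
    finite, being bounded below by [- p (- x)], and is again sublinear. *)
Lemma sublinear_minimal p : sublinear p -> exists q,
  [/\ sublinear q, forall x, q x <= p x &
      forall q', sublinear q' -> (forall x, q' x <= q x) -> q' = q].
Proof.
move=> sp; pose T := {q : V -> R | sublinear q /\ forall x, q x <= p x}.
pose mkT q (sq : sublinear q) qp : T := exist _ q (conj sq qp).
pose below (s t : T) := `[< forall x, sval t x <= sval s x >].
have [| | | |[q [sq qp]] qmin] := @Zorn T below.
- by move=> s; apply/asboolP.
- move=> s t u /asboolP st /asboolP tu; apply/asboolP => x.
  exact: le_trans (tu x) (st x).
- move=> [s hs] [t ht] /asboolP/= ts /asboolP/= st.
  have est : s = t by apply/funext => x; apply/le_anti; rewrite st ts.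
  by case: _ / est ht => ht; congr exist; exact: Prop_irrelevance.
- move=> C totC; have [[s0 Cs0]|C0] := pselect (exists s : T, C s); last first.
    exists (mkT p sp (fun x => lexx (p x))) => s Cs.
    by case: C0; exists s.
  pose D x := [set sval (s : T) x | s in C].
  have D_inf x : has_inf (D x).
    split; first by exists (sval s0 x), s0.
    exists (- p (- x)) => _ [s Cs <-]; have [ss sle] := svalP s.
    by rewrite (le_trans _ (sublinear_lb x ss))// lerN2.
  have D_le x (s : T) : C s -> inf (D x) <= sval s x.
    by move=> Cs; apply: ge_inf; [exact: (D_inf x).2|exists s].
  have sD : sublinear (fun x => inf (D x)).
    split=> [x y|].
      rewrite -lerBlDr; apply: lb_le_inf; first exact: (D_inf x).1.
      move=> _ [s Cs <-]; rewrite lerBlDr -lerBlDl.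
      apply: lb_le_inf; first exact: (D_inf y).1.
      move=> _ [t Ct <-]; rewrite lerBlDl.
      (* Subadditivity of the infimum needs one functional for both points: the smaller of the two
         members of the chain. *)
      have [/asboolP st|/asboolP ts] := totC _ _ Cs Ct.
        rewrite (le_trans (D_le _ _ Ct))// (le_trans ((svalP t).1.1 _ _))//.
        by rewrite lerD2r.
      rewrite (le_trans (D_le _ _ Cs))// (le_trans ((svalP s).1.1 _ _))//.
      by rewrite lerD2l.
    apply: sublinear_homo => [r x r0|].
      rewrite -ler_pdivrMl//; apply: lb_le_inf; first exact: (D_inf x).1.
      move=> _ [s Cs <-]; rewrite ler_pdivrMl// -((svalP s).1.2 _ _ (ltW r0)).
      exact: D_le.
    apply/eqP; rewrite eq_le -{1}(sublinear0 (svalP s0).1) D_le//=.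
    apply: lb_le_inf; first exact: (D_inf 0).1.
    by move=> _ [s Cs <-]; rewrite sublinear0//; exact: (svalP s).1.
  have Dp x : inf (D x) <= p x.
    by rewrite (le_trans (D_le _ _ Cs0))//; exact: (svalP s0).2.
  exists (mkT _ sD Dp) => s Cs; apply/asboolP => x /=.
  exact: D_le.
exists q; split=> // q' sq' q'q.
have q'p x : q' x <= p x by exact: le_trans (qp x).
by have /(congr1 sval) := qmin (mkT _ sq' q'p) (introT (asboolP _) q'q).
Qed.

(* A minimal sublinear functional equals each of its tilts, so it is odd, hence
   linear. *)
Lemma dominated_scalar p b : sublinear p ->
  exists f : {scalar V}, (forall x, f x <= p x) /\ p b <= f b.
Proof.
(* Starting below the tilt of [p] at [b] forces [q (- b) <= - p b], which becomes [p b <= f b] by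
   oddness. *)
move=> sp; have [q [sq qp qmin]] := sublinear_minimal (sublinear_tilt b sp).
have qN x : q (- x) = - q x.
  apply/eqP; rewrite eq_le -{1}(qmin _ (sublinear_tilt x sq) (le_tilt x sq)).
  by rewrite tilt_opp//= -{1}(opprK x) sublinear_lb.
have qD x y : q (x + y) = q x + q y.
  apply/eqP; rewrite eq_le sq.1/= -lerN2 -qN !opprD -!qN.
  exact: sq.1.
have qZ r x : q (r *: x) = r * q x.
  have [r0|r0] := leP 0 r; first exact: sq.2.
  by rewrite -[r in LHS]opprK scaleNr qN sq.2 ?oppr_ge0 ?ltW// mulNr opprK.
have ql : scalar q by move=> r x y; rewrite qD qZ.
pose qL := GRing.isLinear.Build _ _ _ _ q ql.
pose f : {scalar V} := HB.pack q qL.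
exists f; split=> [x|]; first exact: le_trans (le_tilt _ sp x).
by rewrite -lerN2 -[- f b]qN (le_trans (qp _))// tilt_opp.
Qed.

End sublinear.

(** * States *)

(** Restriction of scalars, under a new name so that the real structure does not clash with the
    complex one. *)
Definition realify (R : realType) (V : lmodType R[i]) : Type := V.

Section realify.
Context (R : realType) (V : lmodType R[i]).

HB.instance Definition _ := GRing.Zmodule.copy (realify V) V.

Let realify_scale (r : R) (x : realify V) : realify V := r%:C%C *: (x : V).

Fact realify_scaleA a b x :
  realify_scale a (realify_scale b x) = realify_scale (a * b) x.
Proof. by rewrite /realify_scale scalerA -rmorphM. Qed.

Fact realify_scale1 : left_id 1 realify_scale.
Proof. exact: scale1r. Qed.

Fact realify_scaleDr : right_distributive realify_scale +%R.
Proof. by move=> a; exact: scalerDr. Qed.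

Fact realify_scaleDl x : {morph realify_scale^~ x : a b / a + b}.
Proof. by move=> a b; rewrite /realify_scale rmorphD scalerDl. Qed.

HB.instance Definition _ := GRing.Zmodule_isLmodule.Build R (realify V)
  realify_scaleA realify_scale1 realify_scaleDr realify_scaleDl.

End realify.

Section state.
Context (R : realType) (A : unitalCstarAlgType R).
Implicit Types (h x y : A) (c r : R).
Local Notation "c %:S" := (c%:C%C *: (1 : A)) (at level 1, format "c %:S").

Hypothesis A1 : (1 : A) <> 0.

Lemma positive0 : positive (0 : A).
Proof. by rewrite -(scale0r (1 : A)); exact: (@positive_scalar _ A 0). Qed.

Lemma positive_scalar_ge0 c : positive (c%:S : A) -> 0 <= c.
Proof.
move=> cp; rewrite leNgt; apply/negP => c0.
have /(positive_anti cp)/eqP : positive (- c%:S : A).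
  by rewrite -scaleNr -rmorphN; apply: positive_scalar; rewrite oppr_ge0 ltW.
rewrite scaler_eq0 => /orP[/eqP/complexI c00|/eqP//].
by rewrite c00 ltxx in c0.
Qed.

(* The upper end of the numerical range of the real part of [x]. *)
Let D x := [set c | positive ((2 * c)%:S - (x + star x))].
Definition real_part_sup x := inf (D x).
Local Notation p := real_part_sup.

(** Adding the positive element [2 |x| + x + star x] to [2 c - (x + star x)] leaves the scalar
    [2 (|x| + c)], which is therefore nonnegative. *)
Let D_ge x c : D x c -> - rnorm x <= c.
Proof.
move=> xc.
have : positive ((2 * (rnorm x + c))%:S).
  have -> : (2 * (rnorm x + c))%:S =
      ((2 * c)%:S - (x + star x)) + ((rnorm x)%:S + x + ((rnorm x)%:S + star x)).
    rewrite [X in _ - _ + X]addrACA [RHS]addrACA addNr addr0 -!scalarD.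
    by congr (_%:S); ring.
  apply: positiveD xc _; split.
    by rewrite !starD starK star_scalar [RHS]addrC.
  exists (2 * rnorm x); rewrite mulr_natl mulr2n scalarD addrACA opprD addrA.
  rewrite subrr add0r rnormN (le_trans (rnormD _ _))//.
  by rewrite rnorm_star.
by move/positive_scalar_ge0; rewrite pmulr_rge0// -lerBlDl sub0r.
Qed.

Let D_norm x : D x (rnorm x).
Proof.
split; first by rewrite starB star_scalar starD starK [star x + x]addrC.
exists (2 * rnorm x); rewrite opprB addrC subrK.
by rewrite (le_trans (rnormD _ _))// rnorm_star mulr_natl mulr2n.
Qed.

Let D_inf x : has_inf (D x).
Proof.
by split; [exists (rnorm x); exact: D_norm|exists (- rnorm x) => c; exact: D_ge].
Qed.

Lemma real_part_sup_le x c : positive ((2 * c)%:S - (x + star x)) -> p x <= c.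
Proof. by move=> xc; apply: ge_inf => //; exact: (D_inf x).2. Qed.

Lemma le_real_part_sup x r :
  (forall c, positive ((2 * c)%:S - (x + star x)) -> r <= c) -> r <= p x.
Proof. by move=> xr; apply: lb_le_inf; [exact: (D_inf x).1|exact: xr]. Qed.

Lemma sublinear_real_part_sup : sublinear (p : realify A -> R).
Proof.
split=> [x y|].
  rewrite -lerBlDr; apply: le_real_part_sup => c xc.
  rewrite lerBlDr -lerBlDl; apply: le_real_part_sup => d yd.
  rewrite lerBlDl; apply: real_part_sup_le.
  rewrite mulrDr scalarD starD addrACA opprD addrACA.
  exact: positiveD.
apply: sublinear_homo => [r x r0|].
  rewrite -ler_pdivrMl//; apply: le_real_part_sup => c xc.
  rewrite ler_pdivrMl//; apply: real_part_sup_le.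
  rewrite mulrCA -scaleZr starZr -scalerDr -scalerBr.
  by apply: positiveZ => //; exact: ltW.
apply/eqP; rewrite eq_le real_part_sup_le ?le_real_part_sup// => [c|].
  rewrite star0 addr0 subr0 => /positive_scalar_ge0.
  by rewrite pmulr_rge0.
by rewrite star0 addr0 subr0 mulr0; exact: positive_scalar.
Qed.

(** A real functional [g] dominated by [real_part_sup] and at least equal to it at [h] is
    nonnegative on positive elements and zero on skew ones; [f] is its complexification. At a
    positive [h] the supremum is at least [|h|]. *)
Lemma exists_state_nontrivial h : positive h -> exists f : {scalar A},
  [/\ forall x, 0 <= f (star x * x), f 1 <= 1,
      forall x, f (star x) = (f x)^* & (rnorm h)%:C%C <= f h].
Proof.
move=> hp.
have [g [gp gh]] := dominated_scalar (h : realify A) sublinear_real_part_sup.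
have gD (x y : A) : g (x + y : A) = g x + g y by exact: (raddfD g).
have gZ r (x : A) : g (r %:* x) = r * g x by exact: (linearZ_LR g).
have gN (x : A) : g (- x : A) = - g x by exact: (raddfN g).
have g_pos (x : A) : positive x -> 0 <= g x.
  move=> xp; rewrite -oppr_le0 -gN (le_trans (gp _))//.
  apply: real_part_sup_le; rewrite mulr0 scale0r sub0r starN -opprD opprK.
  by rewrite (positive_star xp); exact: positiveD.
have g_skew (x : A) : star x = - x -> g x = 0.
  move=> xs; have p0 (z : A) : star z = - z -> g z <= 0.
    move=> zs; rewrite (le_trans (gp _))//; apply: real_part_sup_le.
    by rewrite zs mulr0 scale0r subrr subr0; exact: positive0.
  by apply/eqP; rewrite eq_le p0//= -oppr_le0 -gN p0// starN xs.
have i_sq (x : A) : 'i%C *: ('i%C *: x) = - x.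
  by rewrite scalerA -(expr2 'i%C) sqr_i scaleN1r.
have g_star (x : A) : g (star x) = g x.
  by apply/eqP; rewrite -subr_eq0 -gN -gD g_skew// starB starK opprB.
(* The complex-linear functional with real part [g]; it is real on selfadjoint elements because [g]
   vanishes on skew ones. *)
pose f (x : A) : R[i] := Complex (g x) (- g ('i%C *: x)).
have f_lin : scalar f.
  move=> [a b] x y; rewrite /f.
  have -> : (Complex a b) *: x = a %:* x + b %:* ('i%C *: x).
    by rewrite {1}[Complex a b]complexE scalerDl /= mulrC scalerA.
  have -> : 'i%C *: (a %:* x + b %:* ('i%C *: x) + y) =
      a %:* ('i%C *: x) - b %:* x + 'i%C *: y.
    rewrite !scalerDr scalerA mulrC -scalerA; congr (_ + _ + _).
    by rewrite scalerA mulrC -scalerA i_sq scalerN.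
  rewrite !gD gN !gZ; apply/eqP; rewrite eq_complex /=.
  by apply/andP; split; apply/eqP; ring.
pose fL : {scalar A} := HB.pack f (GRing.isLinear.Build _ _ _ _ f f_lin).
have f_real (x : A) : star x = x -> f x = (g x)%:C%C.
  by move=> xs; rewrite /f (g_skew ('i%C *: x)) ?oppr0// starZ conj_i xs scaleNr.
exists fL; split => /=.
- move=> x; rewrite f_real ?ler0c; last by rewrite starMr starK.
  by apply: g_pos; exact: positive_star_mul.
- rewrite f_real ?star1// lecR (le_trans (gp _))//; apply: real_part_sup_le.
  rewrite star1 mulr1 rmorph_nat scaler_nat mulr2n subrr.
  exact: positive0.
- move=> x; rewrite /f.
  have -> : g ('i%C *: star x) = - g ('i%C *: x).
    by rewrite -[in RHS]g_star starZ conj_i scaleNr gN opprK.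
  by apply/eqP; rewrite g_star eq_complex /= !eqxx.
- rewrite f_real ?(positive_star hp)// lecR (le_trans _ gh)//.
  apply: le_real_part_sup => c hc.
  have hc' : positive (c%:S - h).
    have -> : c%:S - h = 2^-1 %:* ((2 * c)%:S - (h + star h)).
      have -> : h + star h = 2 %:* h.
        by rewrite (positive_star hp) rmorph_nat scaler_nat mulr2n.
      by rewrite scalerBr !scaleZr mulrA mulVf ?pnatr_eq0// mul1r scale1r.
    by apply: positiveZ => //; rewrite invr_ge0.
  apply: positive_le_scalar => //; apply: positive_scalar_ge0.
  by rewrite -(subrK h c%:S); exact: positiveD.
Qed.

End state.

(** In the zero algebra the zero functional serves, as [h] itself is 0. *)
Lemma exists_state (R : realType) (A : unitalCstarAlgType R) (h : A) :
  positive h -> exists f : {scalar A},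
  [/\ forall x : A, 0 <= f (star x * x), f 1 <= 1,
      forall x : A, f (star x) = (f x)^* & (rnorm h)%:C%C <= f h].
Proof.
move=> hp; have [A1|A1] := pselect ((1 : A) = 0); last exact: exists_state_nontrivial.
have x0 (x : A) : x = 0 by rewrite -[x]mulr1 A1 mulr0.
exists (\0%R : {scalar A}); split=> //= [x|].
  by rewrite conjC0.
by rewrite (x0 h) rnorm0.
Qed.

(** * Semidefinite forms and Hilbert completion *)

Section complex_norm.
Context (R : realType).
Implicit Types (z w : R[i]) (r : R).

Lemma rnormcM z w : rnorm (z * w) = rnorm z * rnorm w.
Proof. by apply: complexI; rewrite rmorphM /= -!rnormE normrM. Qed.

Lemma rnormcJ z : rnorm (z^*) = rnorm z.
Proof. by rewrite /rnorm norm_conjC. Qed.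

Lemma rnorm_realc r : rnorm (r%:C%C : R[i]) = `|r|.
Proof. by rewrite /rnorm normc_def /= expr0n addr0 sqrtr_sqr. Qed.

Lemma rnormcK z : z * z^* = (rnorm z ^+ 2)%:C%C.
Proof. by rewrite -normCK rmorphXn /= -rnormE. Qed.

Lemma rnormci : rnorm ('i%C : R[i]) = 1.
Proof. by rewrite /rnorm normc_def /= expr0n expr1n add0r sqrtr1. Qed.

Lemma Re_le_rnorm z : `|complex.Re z| <= rnorm z.
Proof. by rewrite -lecR -rnormE normc_ge_Re. Qed.

Lemma Im_le_rnorm z : `|complex.Im z| <= rnorm z.
Proof.
by have := Re_le_rnorm (z * 'i%C); rewrite ReiNIm normrN rnormcM rnormci mulr1.
Qed.

Lemma rnorm_le_ReIm z : rnorm z <= `|complex.Re z| + `|complex.Im z|.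
Proof.
rewrite {1}[z]complexE (le_trans (rnormD _ _))// rnormcM !rnorm_realc.
by rewrite rnormci mul1r.
Qed.

End complex_norm.

(** * Limits with an explicit rate of convergence *)

Section harmonic_rate.
Context (R : realType).

Definition rate (n : nat) : R := n.+1%:R^-1.

Lemma rate_gt0 n : 0 < rate n.
Proof. by rewrite invr_gt0. Qed.

Lemma rate_small (e : R) : 0 < e -> exists n, rate n <= e.
Proof.
move=> e0; exists (Num.truncn e^-1); rewrite invf_ple ?posrE// ltW//.
by rewrite truncnS_gt.
Qed.

Lemma le_rate (a b c : R) : (forall n, a <= b + c * rate n) -> a <= b.
Proof.
move=> abc; apply/ler_addgt0Pr => e e0.
have c1 : 0 < `|c| + 1 by rewrite ltr_wpDl.
have [n ne] := rate_small (divr_gt0 e0 c1).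
rewrite (le_trans (abc n))// lerD2l.
have := rate_gt0 n; have := ler_norm c.
by move: ne; rewrite ler_pdivlMr//; nra.
Qed.

Lemma rate_cauchyR (u : nat -> R) (c : R) :
  (forall n m, `|u n - u m| <= c * (rate n + rate m)) ->
  exists l, forall n, `|u n - l| <= c * rate n.
Proof.
(* The intervals of radius [c * rate n] around [u n] meet pairwise, so the supremum of their left
   ends lies in all of them. *)
move=> cu; pose D := range (fun n => u n - c * rate n).
have D_ub m : ubound D (u m + c * rate m).
  move=> _ [n _ <-]; have /ler_normlP[_] := cu n m.
  rewrite mulrDr; lra.
have D0 : D !=set0 by exists (u 0%N - c * rate 0), 0%N.
exists (sup D) => n; apply/ler_normlP; split.
  have : sup D <= u n + c * rate n by apply: ge_sup.
  lra.
have : u n - c * rate n <= sup D.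
  by apply: ub_le_sup; [exists (u 0%N + c * rate 0); exact: D_ub|exists n].
lra.
Qed.

Lemma rate_cauchy (u : nat -> R[i]) (c : R) :
  (forall n m, rnorm (u n - u m) <= c * (rate n + rate m)) ->
  exists l, forall n, rnorm (u n - l) <= 2 * c * rate n.
Proof.
move=> cu.
have [|a ua] := @rate_cauchyR (fun n => complex.Re (u n)) c.
  move=> n m; rewrite (le_trans _ (cu n m))//.
  by rewrite -(raddfB (@complex.Re R : Rcomplex R -> R)) Re_le_rnorm.
have [|b ub] := @rate_cauchyR (fun n => complex.Im (u n)) c.
  move=> n m; rewrite (le_trans _ (cu n m))//.
  by rewrite -(raddfB (@complex.Im R : Rcomplex R -> R)) Im_le_rnorm.
exists (Complex a b) => n; rewrite (le_trans (rnorm_le_ReIm _))//.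
have := ua n; have := ub n; case: (u n) => x y /=; lra.
Qed.

End harmonic_rate.

(** Nonzero null vectors are allowed, since the form defined by a state may have them; the Riesz
    embedding sends them to 0, so no quotient has to be formed. *)
Record semidot (R : realType) (V : lmodType R[i]) := Semidot {
  sdot :> V -> V -> R[i] ;
  sdot_linear : forall y, scalar (sdot^~ y) ;
  sdotC : forall x y, sdot x y = (sdot y x)^* ;
  sdot_ge0 : forall x, 0 <= sdot x x
}.

Section semidot_theory.
Context (R : realType) (V : lmodType R[i]) (B : semidot V).
Implicit Types (x y z : V) (a : R[i]) (c : R).

Lemma sdotDl x y z : B (x + y) z = B x z + B y z.
Proof. by have := sdot_linear B z 1 x y; rewrite scale1r mul1r. Qed.

Lemma sdot0l z : B 0 z = 0.
Proof. by apply: (addrI (B 0 z)); rewrite -sdotDl !addr0. Qed.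

Lemma sdotZl a x z : B (a *: x) z = a * B x z.
Proof. by rewrite -[a *: x]addr0 (sdot_linear B z a x 0) sdot0l addr0. Qed.

Lemma sdotNl x z : B (- x) z = - B x z.
Proof. by rewrite -scaleN1r sdotZl mulN1r. Qed.

Lemma sdotBl x y z : B (x - y) z = B x z - B y z.
Proof. by rewrite sdotDl sdotNl. Qed.

Lemma sdotDr x y z : B z (x + y) = B z x + B z y.
Proof. by rewrite sdotC sdotDl rmorphD /= -!sdotC. Qed.

Lemma sdotZr a x z : B z (a *: x) = a^* * B z x.
Proof. by rewrite sdotC sdotZl rmorphM /= -sdotC. Qed.

Lemma sdotNr x z : B z (- x) = - B z x.
Proof. by rewrite sdotC sdotNl rmorphN /= -sdotC. Qed.

Lemma sdotBr x y z : B z (x - y) = B z x - B z y.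
Proof. by rewrite sdotDr sdotNr. Qed.

Definition seminorm x : R := Num.sqrt (complex.Re (B x x)).
Local Notation sn := seminorm.

Lemma seminorm_ge0 x : 0 <= sn x. Proof. exact: sqrtr_ge0. Qed.
Hint Resolve seminorm_ge0 : core.

Lemma seminormK x : B x x = (sn x ^+ 2)%:C%C.
Proof.
rewrite sqr_sqrtr ?RRe_real ?ger0_real ?sdot_ge0//.
by have := sdot_ge0 B x; rewrite lecE => /andP[].
Qed.

Lemma seminorm_eqP x c : 0 <= c -> B x x = (c ^+ 2)%:C%C -> sn x = c.
Proof. by move=> c0; rewrite /sn => ->; rewrite /= sqrtr_sqr ger0_norm. Qed.

Lemma cauchy_schwarz x y : rnorm (B x y) <= sn x * sn y.
Proof.
set b := B x y; have [be beE] : {be | be = rnorm b ^+ 2} by exists (rnorm b ^+ 2).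
(* Positivity of the form at [x - s b y], for real [s] and [b = B x y]. *)
have quad s : 0 <= sn x ^+ 2 - (s + s) * be + s ^+ 2 * be * sn y ^+ 2.
  have bb : b * b^* = be%:C%C by rewrite beE; exact: rnormcK.
  rewrite -ler0c; suff <- : B (x - (s%:C%C * b) *: y) (x - (s%:C%C * b) *: y) =
    (sn x ^+ 2 - (s + s) * be + s ^+ 2 * be * sn y ^+ 2)%:C%C by exact: sdot_ge0.
  rewrite !(sdotBl, sdotBr, sdotZl, sdotZr) !seminormK (sdotC B y x) -/b.
  rewrite (rmorphM Num.conj) /= conj_realc.
  rewrite !(rmorphN, rmorphD, rmorphM, rmorphXn) /= -bb.
  by ring.
rewrite -(@ler_pXn2r _ 2) ?nnegrE ?rnorm_ge0 ?mulr_ge0// -beE exprMn.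
have be0 : 0 <= be by rewrite beE; exact: sqr_ge0.
have [y0|y0] := eqVneq (sn y) 0.
  rewrite y0 expr0n mulr0 leNgt; apply/negP => be1.
  (* At a null vector [y] the quadratic is affine in [s], and here takes the value [- 1]. *)
  have := quad ((sn x ^+ 2 + 1) / (2 * be)).
  rewrite y0 expr0n mulr0 addr0 (_ : (_ + _) * be = sn x ^+ 2 + 1).
    by rewrite opprD addrA subrr add0r oppr_ge0 ler10.
  by field; rewrite gt_eqF.
have y1 : 0 < sn y ^+ 2 by rewrite exprn_even_gt0.
(* The minimiser of the quadratic. *)
have := quad (sn y ^+ 2)^-1.
rewrite (_ : _ + _ = sn x ^+ 2 - be / sn y ^+ 2).
  by rewrite subr_ge0 ler_pdivrMr.
by field.
Qed.

Lemma seminormZ a x : sn (a *: x) = rnorm a * sn x.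
Proof.
apply: seminorm_eqP; first exact: mulr_ge0 (rnorm_ge0 _) (seminorm_ge0 _).
by rewrite sdotZl sdotZr mulrA rnormcK seminormK exprMn [RHS]rmorphM.
Qed.

Lemma seminormN x : sn (- x) = sn x.
Proof. by rewrite /sn sdotNl sdotNr opprK. Qed.

Lemma seminormD x y : sn (x + y) <= sn x + sn y.
Proof.
rewrite -(@ler_pXn2r _ 2) ?nnegrE ?addr_ge0//.
have -> : sn (x + y) ^+ 2 =
    sn x ^+ 2 + sn y ^+ 2 + (complex.Re (B x y) + complex.Re (B x y)).
  apply: complexI; rewrite -seminormK sdotDl !sdotDr !seminormK (sdotC B y x).
  rewrite !rmorphD /= (_ : (complex.Re _)%:C%C + _ = B x y + (B x y)^*).
    by ring.
  by rewrite [B x y + _](addcJ (B x y)) mulr_natl mulr2n.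
have := cauchy_schwarz x y; have := Re_le_rnorm (B x y).
by have := ler_norm (complex.Re (B x y)); nra.
Qed.

Lemma seminorm_le x c : 0 <= c -> (forall y, rnorm (B x y) <= c * sn y) ->
  sn x <= c.
Proof.
move=> c0 /(_ x); rewrite seminormK rnorm_realc ger0_norm ?sqr_ge0// expr2.
have [->//|x0] := eqVneq (sn x) 0.
by rewrite ler_pM2r// lt_neqAle eq_sym x0 /=.
Qed.

End semidot_theory.
#[global] Hint Resolve seminorm_ge0 : core.

(** * The completion as a space of antilinear functionals *)

Section completion.
Context (R : realType) (V : lmodType R[i]) (B : semidot V).
Local Notation sn := (seminorm B).
Implicit Types (x y z : V) (h k : V -> R[i]) (d e : R).

(** [h] is within [e], for the dual norm, of the Riesz image of [x]. *)
Definition represents h x e := forall y, rnorm (h y - B x y) <= e * sn y.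

(* The Riesz representation embeds [V] in its antidual by [x |-> B x]; the
   completion of [V] is the norm closure of the image. *)
Definition riesz_closure : {pred V -> R[i]} :=
  fun h => `[< forall e, 0 < e -> exists x, represents h x e >].

Lemma represents_le h x d e : d <= e -> represents h x d -> represents h x e.
Proof.
by move=> de hx y; rewrite (le_trans (hx y))// ler_wpM2r// seminorm_ge0.
Qed.

Lemma represents_self x : represents (B x) x 0.
Proof. by move=> y; rewrite subrr rnorm0 mul0r. Qed.

Lemma representsD h k x y d e : represents h x d -> represents k y e ->
  represents (h + k) (x + y) (d + e).
Proof.
move=> hx ky z; rewrite sdotDl opprD addrACA mulrDl.
by rewrite (le_trans (rnormD _ _))// lerD.
Qed.

Lemma representsZ a h x e : represents h x e ->
  represents (a *: h) (a *: x) (rnorm a * e).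
Proof.
move=> hx y; rewrite sdotZl -[(a *: h) y]/(a * h y) -mulrBr rnormcM -mulrA.
by rewrite ler_wpM2l ?rnorm_ge0.
Qed.

Fact riesz_closure_submod : submod_closed riesz_closure.
Proof.
split=> [|a h k /asboolP hP /asboolP kP].
  apply/asboolP => e e0; exists 0 => y; rewrite sdot0l subr0 rnorm0.
  by apply: mulr_ge0 (ltW e0) _; exact: seminorm_ge0.
apply/asboolP => e e0.
have a1 : 0 < rnorm a + 1 by rewrite ltr_wpDl// rnorm_ge0.
have [x hx] := hP _ (divr_gt0 (divr_gt0 e0 (ltr0Sn _ 1)) a1).
have [y ky] := kP _ (divr_gt0 e0 (ltr0Sn _ 1)).
exists (a *: x + y); apply: represents_le (representsD (representsZ a hx) ky).
rewrite [leRHS](splitr e) lerD2r mulrA ler_pdivrMr// mulrC ler_wpM2l//.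
  by rewrite divr_ge0// ltW.
by rewrite lerDl.
Qed.

HB.instance Definition _ := GRing.isSubmodClosed.Build R[i] (V -> R[i])
  riesz_closure riesz_closure_submod.

Record hcompletion := HCompletion {
  hcompletion_fun :> V -> R[i] ; _ : hcompletion_fun \in riesz_closure }.

HB.instance Definition _ := [isSub for hcompletion_fun].
HB.instance Definition _ := [Choice of hcompletion by <:].
HB.instance Definition _ := [SubChoice_isSubLmodule of hcompletion by <:].

End completion.

Lemma rnorm_rate_eq (R : realType) (W : normedModType R[i]) (z w : W) (c : R) :
  (forall n, rnorm (z - w) <= c * rate R n) -> z = w.
Proof.
move=> zw; apply: rnorm_le_eps => e e0.
have /le_trans -> // : rnorm (z - w) <= 0; last exact: ltW.
by apply: (@le_rate _ _ _ c) => n; rewrite add0r.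
Qed.

Section completion_theory.
Context (R : realType) (V : lmodType R[i]) (B : semidot V).
Local Notation sn := (seminorm B).
Local Notation H := (hcompletion B).
Implicit Types (x y z : V) (h k g : H) (d e c : R).

Lemma hcompletion_ext h k : (forall y, h y = k y) -> h = k.
Proof. by move=> hk; apply: val_inj; apply/funext. Qed.

Lemma hcompletionD h k y : (h + k) y = h y + k y.
Proof. by []. Qed.

Lemma hcompletionZ a h y : (a *: h) y = a * h y.
Proof. by []. Qed.

Lemma hcompletion_approx h e : 0 < e -> exists x, represents B h x e.
Proof. by move=> e0; have /asboolP := valP h; apply. Qed.

Lemma represents_bound h x e : represents B h x e ->
  forall y, rnorm (h y) <= (sn x + e) * sn y.
Proof.
move=> hx y; rewrite -(subrK (B x y) (h y)) (le_trans (rnormD _ _))//.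
by rewrite mulrDl addrC lerD// cauchy_schwarz.
Qed.

Lemma hcompletion_bounded h :
  exists2 c, 0 <= c & forall y, rnorm (h y) <= c * sn y.
Proof.
have [x hx] := hcompletion_approx h ltr01.
by exists (sn x + 1); [rewrite addr_ge0// seminorm_ge0|exact: represents_bound].
Qed.

Lemma represents_seminorm h x e c : 0 <= e -> 0 <= c -> represents B h x e ->
  (forall y, rnorm (h y) <= c * sn y) -> sn x <= c + e.
Proof.
move=> e0 c0 hx hc; apply: seminorm_le => [|y]; first exact: addr_ge0.
rewrite -(subrK (h y) (B x y)) (le_trans (rnormD _ _))// rdistC.
by rewrite mulrDl addrC lerD.
Qed.

Lemma represents_dist h x y d e : 0 <= d -> 0 <= e ->
  represents B h x d -> represents B h y e -> sn (x - y) <= d + e.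
Proof.
move=> d0 e0 hx hy; apply: seminorm_le => [|z]; first exact: addr_ge0.
rewrite sdotBl (le_trans (rdistD _ (h z) _))// mulrDl lerD//.
by rewrite rdistC.
Qed.

Lemma hcompletion_antilinear h a y z : h (a *: y + z) = a^* * h y + h z.
Proof.
pose c := sn (a *: y + z) + (rnorm a * sn y + sn z).
apply: (@rnorm_rate_eq _ _ _ _ c) => n.
have [x hx] := hcompletion_approx h (rate_gt0 R n).
set w := a *: y + z.
have -> : h w - (a^* * h y + h z) =
    (h w - B x w) + - (a^* * (h y - B x y) + (h z - B x z)).
  by rewrite {3}/w sdotDr sdotZr; ring.
rewrite (le_trans (rnormD _ _))// rnormN /c mulrDl lerD//.
  by rewrite mulrC.
rewrite (le_trans (rnormD _ _))// mulrDl lerD//; last by rewrite mulrC.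
by rewrite rnormcM rnormcJ -mulrA ler_wpM2l ?rnorm_ge0// mulrC.
Qed.

Lemma hcompletion_antiB h y z : h (y - z) = h y - h z.
Proof.
by rewrite addrC -scaleN1r hcompletion_antilinear rmorphN1 mulN1r addrC.
Qed.

(* The limit of [h x_n] for any sequence [x_n] approximating [k]. *)
Lemma inner_exists h k : exists l : R[i], forall c, 0 <= c ->
  (forall y, rnorm (h y) <= c * sn y) ->
  forall x d, 0 <= d -> represents B k x d -> rnorm (l - h x) <= c * d.
Proof.
have [c c0 hc] := hcompletion_bounded h.
have /choice[u ku] : forall n, exists x, represents B k x (rate R n).
  by move=> n; apply: hcompletion_approx; exact: rate_gt0.
have r0 n : 0 <= rate R n by exact: ltW (rate_gt0 R n).
have [n m|l ul] := @rate_cauchy R (fun n => h (u n)) c.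
  rewrite -hcompletion_antiB (le_trans (hc _))// ler_wpM2l//.
  exact: represents_dist (ku n) (ku m).
exists l => c' c'0 hc' x d d0 kx.
apply: (@le_rate _ _ _ (2 * c + c')) => n.
rewrite (le_trans (rdistD _ (h (u n)) _))// rdistC mulrDl addrCA lerD//.
rewrite -mulrDr -hcompletion_antiB (le_trans (hc' _))// ler_wpM2l//.
by rewrite [leRHS]addrC; exact: represents_dist (ku n) kx.
Qed.

Definition hinner h k : R[i] := projT1 (cid (inner_exists h k)).

Lemma hinnerP h k c : 0 <= c -> (forall y, rnorm (h y) <= c * sn y) ->
  forall x d, 0 <= d -> represents B k x d -> rnorm (hinner h k - h x) <= c * d.
Proof. by rewrite /hinner; case: cid => l /= lP; exact: lP. Qed.

Lemma hinner_approx h k c d n x y : 0 <= c -> 0 <= d ->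
  (forall y, rnorm (h y) <= c * sn y) -> (forall y, rnorm (k y) <= d * sn y) ->
  represents B h x (rate R n) -> represents B k y (rate R n) ->
  rnorm (hinner h k - B x y) <= (c + (d + 1)) * rate R n.
Proof.
move=> c0 d0 hc kd hx ky; have r0 : 0 <= rate R n by exact: ltW (rate_gt0 R n).
rewrite (le_trans (rdistD _ (h y) _))// mulrDl lerD//; first exact: hinnerP.
rewrite (le_trans (hx _))// mulrC ler_wpM2r//.
(* [y] has seminorm at most [d + rate R n], and the rate is at most 1; this is the origin of
   [d + 1]. *)
rewrite (le_trans (represents_seminorm r0 d0 ky kd))// lerD2l.
by rewrite invf_le1// ler1n.
Qed.

Lemma hinner_linear k : scalar (hinner^~ k).
Proof.
move=> a h g.
have [c c0 hc] := hcompletion_bounded h.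
have [c1 c10 gc] := hcompletion_bounded g.
have [c2 c20 hgc] := hcompletion_bounded (a *: h + g).
apply: (@rnorm_rate_eq _ _ _ _ (c2 + (rnorm a * c + c1))) => n.
have r0 : 0 <= rate R n by exact: ltW (rate_gt0 R n).
have [x kx] := hcompletion_approx k (rate_gt0 R n).
have -> : hinner (a *: h + g) k - (a * hinner h k + hinner g k) =
  (hinner (a *: h + g) k - (a *: h + g) x) -
  (a * (hinner h k - h x) + (hinner g k - g x)).
  by rewrite hcompletionD hcompletionZ; ring.
rewrite (le_trans (rnormB _ _))// mulrDl lerD//; first exact: hinnerP.
rewrite (le_trans (rnormD _ _))// mulrDl lerD//; last exact: hinnerP.
by rewrite rnormcM -mulrA ler_wpM2l ?rnorm_ge0//; exact: hinnerP.
Qed.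

Lemma hinnerC h k : hinner h k = (hinner k h)^*.
Proof.
have [c c0 hc] := hcompletion_bounded h.
have [d d0 kd] := hcompletion_bounded k.
apply: (@rnorm_rate_eq _ _ _ _ ((c + (d + 1)) + (d + (c + 1)))) => n.
have [x hx] := hcompletion_approx h (rate_gt0 R n).
have [y ky] := hcompletion_approx k (rate_gt0 R n).
rewrite (le_trans (rdistD _ (B x y) _))// mulrDl lerD//.
  exact: hinner_approx.
by rewrite sdotC -rmorphB rnormcJ rdistC; exact: hinner_approx.
Qed.

Lemma hinner_ge0 h : 0 <= hinner h h.
Proof.
have [c c0 hc] := hcompletion_bounded h.
rewrite lecE; apply/andP; split.
  have := hinnerC h h; case: (hinner h h) => a b /eqP.
  by rewrite eq_complex /= => /andP[_ /eqP]; rewrite eq_sym => ?; apply/eqP; lra.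
apply: (@le_rate _ _ _ (c + (c + 1))) => n.
have [x hx] := hcompletion_approx h (rate_gt0 R n).
have := hinner_approx c0 c0 hc hc hx hx.
have := Re_le_rnorm (hinner h h - B x x).
rewrite (raddfB (@complex.Re R : Rcomplex R -> R)) => h1 h2.
have := le_trans h1 h2; rewrite distrC => /ler_normlP[_].
rewrite lerBlDl; apply: le_trans.
by have := sdot_ge0 B x; rewrite lecE => /andP[].
Qed.

Definition hdot : semidot H := Semidot hinner_linear hinnerC hinner_ge0.

Fact riesz_in_closure x : B x \in riesz_closure B.
Proof.
apply/asboolP => e /ltW e0; exists x.
exact: represents_le e0 (represents_self B x).
Qed.

Definition hriesz x : H := HCompletion (riesz_in_closure x).

(** The reproducing property: [y] represents [hriesz y] with error 0. *)
Lemma hinner_riesz h y : hinner h (hriesz y) = h y.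
Proof.
have [c c0 hc] := hcompletion_bounded h.
apply: rnorm_le_eps => e e0.
rewrite (le_trans (hinnerP (k := hriesz y) c0 hc (lexx 0) (represents_self B y)))//.
by rewrite mulr0 ltW.
Qed.

Definition hnorm h : R := seminorm hdot h.

Lemma hnorm_riesz x : hnorm (hriesz x) = sn x.
Proof.
by apply: seminorm_eqP; [exact: seminorm_ge0|rewrite /= hinner_riesz /= seminormK].
Qed.

Lemma hcompletion_le h y : rnorm (h y) <= hnorm h * sn y.
Proof. by rewrite -hinner_riesz -hnorm_riesz; exact: (cauchy_schwarz hdot). Qed.

(** Together with [hcompletion_le], this identifies the Hilbert norm with the dual norm, so that
    operators and approximations can be estimated pointwise. *)
Lemma hnorm_le h c : 0 <= c -> (forall y, rnorm (h y) <= c * sn y) ->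
  hnorm h <= c.
Proof.
move=> c0 hc; apply: seminorm_le => // k.
apply: (@le_rate _ _ _ (2 * c)) => n.
have r0 : 0 <= rate R n by exact: ltW (rate_gt0 R n).
have [y ky] := hcompletion_approx k (rate_gt0 R n).
rewrite -(subrK (h y) (hdot h k)) (le_trans (rnormD _ _))//.
have := hinnerP c0 hc r0 ky; have := hc y.
have := represents_seminorm r0 (seminorm_ge0 hdot k) ky (hcompletion_le k).
rewrite /=; nra.
Qed.

Lemma hnorm_represents h x e : 0 <= e -> represents B h x e ->
  hnorm (h - hriesz x) <= e.
Proof. by move=> e0 hx; apply: hnorm_le. Qed.

Fact hnormD h k : (hnorm (h + k))%:C%C <= (hnorm h)%:C%C + (hnorm k)%:C%C.
Proof. by rewrite -rmorphD lecR; exact: seminormD. Qed.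

Fact hnormZ a h : (hnorm (a *: h))%:C%C = `|a| * (hnorm h)%:C%C.
Proof. by rewrite rnormE -rmorphM /hnorm seminormZ. Qed.

Fact hnorm_eq0 h : (hnorm h)%:C%C = 0 -> h = 0.
Proof.
move=> /complexI h0; apply: hcompletion_ext => y; apply: rnorm_eq0.
apply/eqP; rewrite eq_le rnorm_ge0 andbT.
by rewrite (le_trans (hcompletion_le h y))// h0 mul0r.
Qed.

HB.instance Definition _ := Lmodule_isNormed.Build R[i] H hnormD hnormZ hnorm_eq0.

Lemma rnorm_hcompletion h : rnorm h = hnorm h.
Proof. by []. Qed.

(** A Cauchy filter is approximated by Riesz images of vectors [u n]; the functionals [B (u n)]
    converge pointwise, at a rate uniform for the seminorm, to an element of the closure, which is
    the limit of the filter. *)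
Fact hcompletion_complete (F : set_system H) :
  ProperFilter F -> cauchy F -> cvg F.
Proof.
move=> FF /cauchyP cF.
have r0 n : 0 <= rate R n by exact: ltW (rate_gt0 R n).
have /choice[u Fu] : forall n, exists x,
    F [set g | hnorm (g - hriesz x) <= rate R n].
  move=> n; have r2 : 0 < rate R n / 2 by rewrite divr_gt0// rate_gt0.
  have [|g Fg] := cF (rate R n / 2)%:C%C; first by rewrite ltcR.
  have [x gx] := hcompletion_approx g r2; exists x.
  apply: filterS Fg => g'; rewrite -ball_normE /= rnorm_lt => gg'.
  rewrite -(rnorm_hcompletion) (le_trans (rdistD _ g _))// [leRHS]splitr lerD//.
    by rewrite rdistC ltW.
  by apply: hnorm_represents => //; exact: ltW.
have u_dist n m : sn (u n - u m) <= rate R n + rate R m.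
  have [g [/= gn gm]] := filter_ex (filterI (Fu n) (Fu m)).
  have -> : sn (u n - u m) = rnorm (hriesz (u n) - hriesz (u m)).
    rewrite -hnorm_riesz; congr hnorm; apply: hcompletion_ext => y.
    exact: sdotBl.
  by rewrite (le_trans (rdistD _ g _))// lerD// rdistC.
have /choice[l ul] : forall y, exists l, forall n,
    rnorm (B (u n) y - l) <= 2 * sn y * rate R n.
  move=> y; apply: rate_cauchy => n m; rewrite -sdotBl.
  by rewrite (le_trans (cauchy_schwarz B _ _))// mulrC ler_wpM2l// seminorm_ge0.
have lu n : represents B l (u n) (2 * rate R n).
  by move=> y; rewrite rdistC mulrAC.
have lP : l \in riesz_closure B.
  apply/asboolP => e e0; have [n ne] := rate_small (divr_gt0 e0 (ltr0Sn _ 1)).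
  exists (u n); apply: represents_le (lu n).
  by rewrite mulrC -ler_pdivlMr.
apply/cvg_ex; exists (HCompletion lP); apply/cvgrPdist_le => e e0.
have er : e = (complex.Re e)%:C%C by rewrite RRe_real// gtr0_real.
have [n ne] : exists n, rate R n <= complex.Re e / 3.
  by apply: rate_small; rewrite divr_gt0// -ltcR -er.
apply: filterS (Fu n) => g /= gu; rewrite er rnorm_le.
rewrite (le_trans (rdistD _ (hriesz (u n)) _))// rdistC.
have : rnorm (hriesz (u n) - HCompletion lP) <= 2 * rate R n.
  by rewrite rdistC; apply: hnorm_represents => //; rewrite mulr_ge0.
have : rnorm (hriesz (u n) - g) <= rate R n by rewrite rdistC.
by move: ne; rewrite ler_pdivlMr//; lra.
Qed.

HB.instance Definition _ := Uniform_isComplete.Build H hcompletion_complete.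

End completion_theory.

(** * The GNS construction *)

Lemma bounded_linear_continuous (R : realType) (V W : normedModType R[i])
    (T : {linear V -> W}) (c : R) :
  0 <= c -> (forall x, rnorm (T x) <= c * rnorm x) -> continuous T.
Proof.
move=> c0 Tc h; apply/cvgrPdist_le => e e0.
have er : e = (complex.Re e)%:C%C by rewrite RRe_real// gtr0_real.
have c1 : 0 < c + 1 by rewrite ltr_wpDl.
have d0 : 0 < complex.Re e / (c + 1) by rewrite divr_gt0// -ltcR -er.
near=> g; rewrite -raddfB er rnorm_le (le_trans (Tc _))//.
have : rnorm (h - g) <= complex.Re e / (c + 1).
  by rewrite -rnorm_le; near: g; apply: cvgr_dist_le; rewrite ?ltcR.
by rewrite ler_pdivlMr//; have := rnorm_ge0 (h - g); nra.
Unshelve. all: by end_near. Qed.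

Section completion_hilbert.
Context (R : realType) (V : lmodType R[i]) (B : semidot V).
Local Notation H := (hcompletion B).

HB.instance Definition _ := @isBilinear.Build R[i] H H R[i] *%R (Num.conj \; *%R)
  (@hinner R V B)
  (fun k h g => sdotBl (hdot B) h g k) (fun h k g => sdotBr (hdot B) k g h)
  (fun k a h => sdotZl (hdot B) a h k) (fun h a k => sdotZr (hdot B) a k h).

Fact hinner_hermitian (h k : H) : hinner h k = (-1) ^+ false * (hinner k h)^*.
Proof. by rewrite expr0 mul1r hinnerC. Qed.

HB.instance Definition _ := @isHermitianSesquilinear.Build R[i] H false Num.conj
  (@hinner R V B) hinner_hermitian.

Lemma hnormK (h : H) : `|h| ^+ 2 = hinner h h.
Proof. by rewrite rnormE -rmorphXn; exact/esym/(seminormK (hdot B)). Qed.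

Fact hinner_gt0 (h : H) : h != 0 -> 0 < hinner h h.
Proof. by move=> h0; rewrite -hnormK exprn_gt0// normr_gt0. Qed.

HB.instance Definition _ := @isDotProduct.Build R[i] H (@hinner R V B) hinner_gt0.

Definition hilbert_completion : hilbertType R :=
  @Hilbert R H (@hinner R V B) hnormK.

End completion_hilbert.

Section gns.
Context (R : realType) (A : unitalCstarAlgType R) (f : {scalar A}).
Implicit Types (a b x y : A).
Hypothesis f_star : forall x : A, f (star x) = (f x)^*.
Hypothesis f_ge0 : forall x : A, 0 <= f (star x * x).

Fact gns_linear (y : A) : scalar (fun x => f (star y * x)).
Proof. by move=> a x z; rewrite mulrDr -scaleAr linearP. Qed.

Fact gns_herm (x y : A) : f (star y * x) = (f (star x * y))^*.
Proof. by rewrite -f_star starMr starK. Qed.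

Definition gns_dot : semidot A := Semidot gns_linear gns_herm f_ge0.
Local Notation sn := (seminorm gns_dot).
Local Notation H := (hcompletion gns_dot).

(** [|a|^2 - star a * a] is positive, hence a square [w^2], and [|a|^2 f (star x * x) - f (star (a
    x) * (a x))] equals [f (star (w x) * (w x)) >= 0]. *)
Lemma gns_seminormM a x : sn (a * x) <= rnorm a * sn x.
Proof.
have p2 : positive ((rnorm a ^+ 2)%:C%C *: (1 : A) - star a * a).
  by apply: positive_sub; [exact: positive_star_mul|rewrite rnorm_star_mul].
have [w [ws ww _ _]] := positive_sqrt p2.
rewrite -(@ler_pXn2r _ 2) ?nnegrE ?mulr_ge0 ?rnorm_ge0 ?seminorm_ge0//.
rewrite -lecR exprMn [leRHS]rmorphM /= -!seminormK /= -subr_ge0.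
have -> : (rnorm a ^+ 2)%:C%C * f (star x * x) - f (star (a * x) * (a * x)) =
    f (star (w * x) * (w * x)); last exact: f_ge0.
rewrite !starMr ws -!mulrA (mulrA w) ww (mulrA (star a)) -[_ * f _]linearZ_LR -raddfB.
by rewrite mulrBl mulrBr -scaleAl mul1r -scaleAr.
Qed.

(** As the form at [a x], [y] equals the form at [x], [star a * y], left multiplication by [a] acts
    on functionals by precomposition with [star a]. *)
Lemma gns_represents a (h : A -> R[i]) x e :
  0 <= e -> represents gns_dot h x e ->
  represents gns_dot (fun y => h (star a * y)) (a * x) (e * rnorm a).
Proof.
move=> e0 hx y; have -> : gns_dot (a * x) y = gns_dot x (star a * y).
  by rewrite /= starMr starK mulrA.
rewrite (le_trans (hx _))// -mulrA ler_wpM2l//.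
by rewrite -rnorm_star gns_seminormM.
Qed.

Fact gns_op_in_closure a (h : H) :
  (fun y => h (star a * y)) \in riesz_closure gns_dot.
Proof.
apply/asboolP => e e0.
have a1 : 0 < rnorm a + 1 by rewrite ltr_wpDl// rnorm_ge0.
have [x hx] := hcompletion_approx h (divr_gt0 e0 a1).
exists (a * x); have d0 := ltW (divr_gt0 e0 a1).
apply: represents_le (gns_represents a d0 hx).
by rewrite mulrAC ler_pdivrMr// ler_wpM2l ?lerDl// ltW.
Qed.

Definition gns_op a (h : H) : H := HCompletion (gns_op_in_closure a h).

Fact gns_op_linear a : linear (gns_op a).
Proof. by move=> c h g; exact: hcompletion_ext. Qed.

HB.instance Definition _ a := GRing.isLinear.Build R[i] H H _ (gns_op a) (gns_op_linear a).

Lemma gns_op_le a (h : H) : rnorm (gns_op a h) <= rnorm a * rnorm h.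
Proof.
apply: hnorm_le => [|y]; first by rewrite mulr_ge0// rnorm_ge0.
rewrite (le_trans (hcompletion_le h (star a * y)))// (mulrC (rnorm a)) -mulrA.
by apply: ler_wpM2l; [exact: seminorm_ge0|rewrite -(rnorm_star a) gns_seminormM].
Qed.

Lemma gns_op_continuous a : continuous (gns_op a).
Proof. exact: bounded_linear_continuous (rnorm_ge0 a) (gns_op_le a). Qed.

Lemma gns_opP c a b h : gns_op (c *: a + b) h = c *: gns_op a h + gns_op b h.
Proof.
apply: hcompletion_ext => y.
transitivity (c * h (star a * y) + h (star b * y)); last by [].
by rewrite /= starD starZ mulrDl -scaleAl hcompletion_antilinear conjCK.
Qed.

Lemma gns_opM a b h : gns_op (a * b) h = gns_op a (gns_op b h).
Proof. by apply: hcompletion_ext => y /=; rewrite starMr mulrA. Qed.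

Lemma gns_op_star a h k :
  hinner (gns_op (star a) h) k = hinner h (gns_op a k).
Proof.
have [c c0 hc] := hcompletion_bounded h.
have [d d0 hd] := hcompletion_bounded (gns_op (star a) h).
(* Both sides are approximated by [h (a * y)], where [y] represents [k]. *)
apply: (@rnorm_rate_eq _ _ _ _ (d + c * rnorm a)) => n.
have r0 : 0 <= rate R n by exact: ltW (rate_gt0 R n).
have [y ky] := hcompletion_approx k (rate_gt0 R n).
have /(hinnerP c0 hc) : represents gns_dot (gns_op a k) (a * y) (rate R n * rnorm a).
  exact: gns_represents.
move=> /(_ (mulr_ge0 r0 (rnorm_ge0 a))).
have := hinnerP d0 hd r0 ky; rewrite /= starK => h1 h2.
rewrite (le_trans (rdistD _ (h (a * y)) _))// mulrDl lerD//.
by rewrite rdistC (le_trans h2)// -mulrA [rnorm a * _]mulrC.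
Qed.

Lemma gns_op_riesz a : gns_op a (hriesz gns_dot 1) = hriesz gns_dot a.
Proof.
by apply: hcompletion_ext => y /=; rewrite starMr starK mulr1.
Qed.

End gns.

(** The representation may depend on [a], so one state large at [star a * a] suffices. The class [v]
    of [1] has [|v|^2 = f 1 <= 1], while [|rho a v|^2 = f (star a * a) >= |a|^2]. *)
Lemma gelfand_naimark (R : realType) (A : unitalCstarAlgType R) (a : A) :
  exists (H : hilbertType R) (rho : A -> {linear H -> H}),
  [/\ forall x, continuous (rho x),
      forall c x y v, rho (c *: x + y) v = c *: rho x v + rho y v,
      forall (x y : A) v, rho (x * y) v = rho x (rho y v),
      forall x v w, inner H (rho (star x) v) w = inner H v (rho x w)
    & ((rnorm a)%:E <= opnorm (rho a))%E].
Proof.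
have [f [f_ge0 f1 f_star fa]] := exists_state (positive_star_mul a).
pose H := hilbert_completion (gns_dot f_star f_ge0).
pose rho x : {linear H -> H} := @gns_op R A f f_star f_ge0 x.
exists H, rho; split.
- exact: gns_op_continuous.
- exact: gns_opP.
- exact: gns_opM.
- exact: gns_op_star.
pose v : H := hriesz (gns_dot f_star f_ge0) 1.
have v1 : rnorm v <= 1.
  rewrite [rnorm v]hnorm_riesz -(@ler_pXn2r _ 2) ?nnegrE ?seminorm_ge0//.
  by rewrite -lecR -seminormK /= star1 mulr1 expr1n.
have va : rnorm a <= rnorm (rho a v).
  rewrite /rho /v /= gns_op_riesz [leRHS]hnorm_riesz.
  rewrite -(@ler_pXn2r _ 2) ?nnegrE ?rnorm_ge0 ?seminorm_ge0//.
  by rewrite -lecR -seminormK /= -rnorm_star_mul.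
apply: (@le_trans _ _ (rnorm (rho a v))%:E); first by rewrite lee_fin.
by apply: ereal_sup_ubound; exists v.
Qed.

(** * Fibres of a twist and finitely supported sections *)

Lemma expi_surj (R : realType) (z : circle R) :
  exists2 t : R, t \in `[- pi, pi] & expi t = z.
Proof.
case: z => -[a b] /= z1; have := z1.
rewrite normc_def /= -(rmorph1 (real_complex R)) (inj_eq (@complexI R)).
rewrite -(@eqrXn2 _ 2) ?sqrtr_ge0// sqr_sqrtr ?addr_ge0 ?sqr_ge0// expr1n.
move=> /eqP ab.
have a1 : -1 <= a <= 1 by apply/andP; split; nra.
have ac : cos (acos a) = a by rewrite acosK// in_itv.
have as_ : sin (acos a) = `|b| by rewrite sin_acos// -ab addrC addKr sqrtr_sqr.
have p0 := acos_ge0 a1; have p1 := acos_lepi a1.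
(* [acos a] has sine [|b|], so the sign of [b] decides between [acos a] and its opposite. *)
have [b0|b0] := leP 0 b.
  exists (acos a); first by rewrite in_itv /= p1 andbT; lra.
  by apply: val_inj; rewrite /= ac as_ ger0_norm.
exists (- acos a); first by rewrite in_itv /= lerN2 p1 /=; lra.
by apply: val_inj; rewrite /= cosN sinN ac as_ ltr0_norm// opprK.
Qed.

Lemma circle_compact (R : realType) : compact [set: circle R].
Proof.
have -> : [set: circle R] = (@expi R) @` `[- pi, pi]%classic.
  apply/seteqP; split=> // z _; have [t tp <-] := expi_surj z.
  by exists t.
apply: continuous_compact; last exact: segment_compact.
exact/continuous_subspaceT/continuous_expi.
Qed.

Section fibres.
Context (R : realType) (G : groupType) (E : twist R G).
Local Notation C := R[i].
Local Notation i := (@twist_i R G E).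
Local Notation q := (@twist_q R G E).
Implicit Types (x y : E) (z w : circle R) (a b : G) (f g : E -> C).

Lemma twist_q_i z : q (i z) = 1%g.
Proof.
by have : (q @^-1` [set 1%g]) (i z) by rewrite -twist_exact; exists z.
Qed.

Lemma twist_i1 : i 1%g = 1%g.
Proof. by apply: (mulgI (i 1%g)); rewrite -twist_iM !mulg1. Qed.

Lemma tact1 x : tact 1%g x = x.
Proof. by rewrite /tact twist_i1 mul1g. Qed.

Lemma tactM z w x : tact z (tact w x) = tact (z * w)%g x.
Proof. by rewrite /tact twist_iM mulgA. Qed.

Lemma tact_mull z x y : (tact z x * y)%g = tact z (x * y)%g.
Proof. by rewrite /tact mulgA. Qed.

Lemma tact_mulr z x y : (x * tact z y)%g = tact z (x * y)%g.
Proof. by rewrite /tact mulgA -twist_central mulgA. Qed.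

Lemma tactV z x : (tact z x)^-1%g = tact z^-1%g x^-1%g.
Proof.
apply: (mulgI (tact z x)); rewrite mulgV tact_mull tact_mulr tactM mulgV tact1.
by rewrite mulgV.
Qed.

Lemma twist_q_tact z x : q (tact z x) = q x.
Proof. by rewrite /tact twist_qM twist_q_i mul1g. Qed.

Lemma twist_q1 : q 1%g = 1%g.
Proof. by rewrite -twist_i1 twist_q_i. Qed.

Lemma twist_qV x : q x^-1%g = (q x)^-1%g.
Proof. by apply: (mulgI (q x)); rewrite -twist_qM !mulgV twist_q1. Qed.

Lemma twist_q_inj x y : q x = q y -> exists z, y = tact z x.
Proof.
move=> xy; have : (q @^-1` [set 1%g]) (y * x^-1)%g.
  by rewrite /= twist_qM twist_qV xy mulgV.
rewrite -twist_exact => -[z _ zyx]; exists z.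
by rewrite /tact zyx -mulgA mulVg mulg1.
Qed.

Lemma twist_q_fibre_point a : q (fibre_point E a) = a.
Proof.
rewrite /fibre_point; have [x xa] := twist_q_surj E a.
by apply: (@getPex _ (q @^-1` [set a])); exists x.
Qed.

Definition fibre a : set E := q @^-1` [set a].

Lemma open_fibre a : open (fibre a).
Proof. by have [P _ []] := twist_locally_trivial E a. Qed.

Lemma fibre_tact x : fibre (q x) = [set tact z x | z in [set: circle R]].
Proof.
apply/seteqP; split=> y /=; first by move/esym/twist_q_inj => [z ->]; exists z.
by move=> [z _ <-]; exact: twist_q_tact.
Qed.

Lemma continuous_tact x : continuous (fun z => tact z x).
Proof.
move=> z.
apply: (@continuous_comp _ _ _ (fun z => (i z, x)) (fun p : E * E => (p.1 * p.2)%g)).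
  apply: cvg_pair; [exact: nbhs_filter|exact: (@twist_i_continuous _ _ E z)|].
  exact: (@cst_continuous (circle R) E x z).
exact: mulg_continuous.
Qed.

Lemma compact_fibre a : compact (fibre a).
Proof.
rewrite -(twist_q_fibre_point a) fibre_tact.
apply: continuous_compact; last exact: circle_compact.
exact/continuous_subspaceT/continuous_tact.
Qed.

Definition equivariant f := forall z x, f (tact z x) = val z * f x.

(** On the open fibre of [x], a local trivialisation [g] gives [f y = g y * f P]. *)
Lemma equivariant_continuous f : equivariant f -> continuous f.
Proof.
move=> fE x; have [P Px [oP [_ [g [_ _ gK gc]]]]] := twist_locally_trivial E (q x).
have fg y : fibre (q x) y -> f y = val (g y) * f P.
  by move=> yx; rewrite -fE /tact gK.
rewrite /continuous_at (fg x erefl).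
have : (fun y => val (g y) * f P) y @[y --> x] --> val (g x) * f P.
  apply: cvgMl.
  apply: (@cvg_comp _ _ _ g val _ (nbhs (g x))).
    move: gc; rewrite continuous_open_subspace// => /(_ x); apply.
    exact: mem_set.
  exact: initial_continuous.
apply: cvg_trans; apply: near_eq_cvg.
have := open_nbhs_nbhs (conj (open_fibre (q x)) (erefl : fibre (q x) x)).
by apply: filterS => y /fg ->.
Qed.

Definition carried f (s : seq G) := forall x, f x != 0 -> q x \in s.

Lemma carried_sub f (s s' : seq G) :
  {subset s <= s'} -> carried f s -> carried f s'.
Proof. by move=> ss fs x /fs /ss. Qed.

(** The fibres form an open cover, of which finitely many cover the compact support. *)
Lemma Sigma_c_carried f : Sigma_c f -> exists2 s, uniq s & carried f s.
Proof.
move=> [_ cf fE].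
have := cf; rewrite compact_cover => /(_ G setT fibre) [].
- by move=> a _; exact: open_fibre.
- by move=> x _; exists (q x).
move=> D _ fD; exists (enum_fset D) => [|x fx]; first exact: fset_uniq.
have [|a aD xa] := fD x; first by apply: subset_closure.
by rewrite (_ : q x = a).
Qed.

(** A finite union of fibres is compact, hence closed in the Hausdorff space [E], so it contains the
    closed support. *)
Lemma carried_Sigma_c f s : equivariant f -> carried f s -> Sigma_c f.
Proof.
move=> fE fs; split=> //; first exact: equivariant_continuous.
pose K := \big[setU/set0]_(a <- s) fibre a.
have cK : compact K by apply: bigsetU_compact => a _; exact: compact_fibre.
have fK : [set x | f x != 0] `<=` K.
  move=> x /fs xs; rewrite /K -bigcup_seq; exists (q x) => //.
apply: (subclosed_compact _ cK); first exact: closed_closure.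
rewrite (closure_id K).1; first exact: closure_subset.
by apply: compact_closed cK; exact: twist_hausdorff.
Qed.

End fibres.

Lemma circle_conj (R : realType) (z : circle R) : (val z)^* = (val z)^-1.
Proof.
apply: (mulfI (circle_neq0 z)).
by rewrite -normCK circle_normE expr1n mulfV// circle_neq0.
Qed.

(** * Convolution as a finite sum over fibres *)

Section twisted_convolution.
Context (R : realType) (G : groupType) (E : twist R G).
Local Notation C := R[i].
Local Notation q := (@twist_q R G E).
Local Notation lambda := (@twist_measure R G E).
Implicit Types (x y : E) (z w : circle R) (a b : G) (f g : E -> C) (s : seq G).

Lemma measurable_fibre a : measurable (fibre a : set (borel E)).
Proof. by apply: sub_sigma_algebra; exact: open_fibre. Qed.

Lemma twist_measure_fibre a : lambda (fibre a) = 1%E.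
Proof.
have fm b : @fibre_measure R G E b (fibre a) =
    if b \in [set a] then 1%E else 0%E.
  rewrite /fibre_measure /pushforward.
  have -> : (fun z : borel (circle R) => tact z (fibre_point E b) : borel E) @^-1`
      (fibre a) = if b \in [set a] then setT else set0.
    case: ifPn => [/set_mem/= ->|ba].
      apply/seteqP; split=> // z _.
      by rewrite /fibre /= twist_q_tact twist_q_fibre_point.
    apply/seteqP; split=> // z.
    rewrite /fibre /= twist_q_tact twist_q_fibre_point => ba'.
    by move: ba; rewrite ba' => /negP[]; exact: mem_set.
  by case: ifPn => _; [exact: probability_setT|exact: measure0].
rewrite /twist_measure (eq_esum (fun b _ => fm b)).
by rewrite -esum_mkcond esum_set1.
Qed.

Lemma Rintegral_fibres (r : borel E -> R) s (c : G -> R) : uniq s ->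
  (forall x, r x = \sum_(a <- s) c a * \1_(fibre a) x) ->
  \int[lambda]_x r x = \sum_(a <- s) c a.
Proof.
move=> us rE; rewrite /Rintegral.
have i1 a : lambda.-integrable setT (fun x : borel E => (\1_(fibre a) x)%:E).
  apply/integrableP; split.
    by apply/measurable_EFinP/measurable_indic; exact: measurable_fibre.
  under eq_integral do rewrite gee0_abs//.
  rewrite integral_indic//; last exact: measurable_fibre.
  by rewrite setIT [X in (X < _)%E]twist_measure_fibre ltry.
have -> : (fun x => (r x)%:E) =
    (fun x : borel E => \sum_(a <- s) (c a)%:E * (\1_(fibre a) x)%:E)%E.
  by apply/funext => x; rewrite rE -sumEFin.
rewrite integral_sum//; last by move=> a; exact: integrableZl.
rewrite (eq_bigr (fun a => (c a)%:E)) ?sumEFin// => a _.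
rewrite integralZl// integral_indic//; last exact: measurable_fibre.
by rewrite setIT [X in (_ * X)%E]twist_measure_fibre mule1.
Qed.

(** An invariant function is constant on each fibre, and fibres have mass one; real and imaginary
    parts are integrated separately. *)
Lemma cintegral_fibres (h : E -> C) s : uniq s ->
  (forall z x, h (tact z x) = h x) -> carried h s ->
  cintegral lambda (h : borel E -> C) = \sum_(a <- s) h (fibre_point E a).
Proof.
move=> us hE hs.
have h_part (p : C -> R) : p 0 = 0 -> forall x,
    p (h x) = \sum_(a <- s) p (h (fibre_point E a)) * \1_(fibre a) x.
  move=> p0 x; have hx : h (fibre_point E (q x)) = h x.
    have [z ->] := twist_q_inj (esym (twist_q_fibre_point E (q x))).
    by rewrite hE.
  have ind a : \1_(fibre a) x = (a == q x)%:R :> R.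
    rewrite indicE; congr (_%:R); congr nat_of_bool.
    by apply/idP/idP => [/set_mem <-//|/eqP ->]; exact: mem_set.
  have [xs|xs] := boolP (q x \in s).
    rewrite (bigD1_seq (q x))//= ind eqxx mulr1 hx big1 ?addr0// => a /negPf ax.
    by rewrite ind ax mulr0.
  have -> : h x = 0 by apply/eqP; apply: contraNT xs; exact: hs.
  rewrite big_seq big1 ?p0// => a a_s; rewrite ind.
  by case: eqP => [ax|]; rewrite ?mulr0//; rewrite -ax a_s in xs.
rewrite /cintegral (Rintegral_fibres us (h_part (@complex.Re R) erefl)).
rewrite (Rintegral_fibres us (h_part (@complex.Im R) erefl)).
elim: (s) => [|a s' ih]; first by rewrite !big_nil.
by rewrite !big_cons -ih; case: (h _).
Qed.

(** The integrand [f (x * y^-1) * g y] is constant on fibres in [y]: the two factors contribute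
    inverse phases. *)
Lemma twist_convE f g s x : equivariant f -> equivariant g -> uniq s ->
  carried g s -> twist_conv f g x =
  \sum_(a <- s) f (x * (fibre_point E a)^-1)%g * g (fibre_point E a).
Proof.
move=> fE gE us gs; rewrite /twist_conv.
rewrite (@cintegral_fibres (fun y => f (x * y^-1)%g * g y) s)//.
  move=> z y; rewrite tactV tact_mulr fE gE mulrACA.
  by rewrite mulVf ?mul1r// circle_neq0.
by move=> y; rewrite mulf_eq0 => /norP[_ /gs].
Qed.

Lemma equivariant_conv f g s : equivariant f -> equivariant g -> uniq s ->
  carried g s -> equivariant (twist_conv f g).
Proof.
move=> fE gE us gs z x; rewrite !(twist_convE _ fE gE us gs) mulr_sumr.
by apply: eq_bigr => a _; rewrite tact_mull fE mulrA.
Qed.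

Lemma carried_conv f g s s' : equivariant f -> equivariant g -> uniq s' ->
  carried f s -> carried g s' ->
  carried (twist_conv f g) [seq (a * b)%g | a <- s, b <- s'].
Proof.
move=> fE gE us fs gs x; rewrite (twist_convE _ fE gE us gs) => sum0.
have [/hasP[a a_s' /fs]|] :=
  boolP (has (fun a => f (x * (fibre_point E a)^-1)%g != 0) s').
  rewrite twist_qM twist_qV twist_q_fibre_point => xas.
  by apply/allpairsP; exists (q x * a^-1, a)%g; rewrite /= mulgVK.
move=> /hasPn f0; case/negP: sum0; rewrite big_seq big1// => a /f0.
by rewrite negbK => /eqP ->; rewrite mul0r.
Qed.

Lemma equivariant_invol f : equivariant f -> equivariant (invol f).
Proof.
move=> fE z x; rewrite /invol tactV fE rmorphM; congr (_ * _).
by rewrite [LHS](circle_conj z^-1%g); exact: invrK.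
Qed.

Lemma carried_invol f s : carried f s ->
  carried (invol f) [seq a^-1%g | a <- s].
Proof.
move=> fs x; rewrite /invol conjC_eq0 => /fs; rewrite twist_qV => xs.
by apply/mapP; exists (q x)^-1%g; rewrite ?invgK.
Qed.

Lemma equivariant_delta x : equivariant (delta x).
Proof.
move=> z y; have [[w ->]|yx] := pselect (exists w, y = tact w x).
  by rewrite tactM !delta_tact.
rewrite !delta_out ?mulr0// => w yw; apply: yx; first by exists w.
by exists (z^-1 * w)%g; rewrite -tactM -yw tactM mulVg tact1.
Qed.

Lemma carried_delta x : carried (delta x) [:: q x].
Proof.
move=> y y0; rewrite inE; have [[w ->]|yx] := pselect (exists w, y = tact w x).
  by rewrite twist_q_tact.
by move: y0; rewrite delta_out ?eqxx// => w yw; apply: yx; exists w.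
Qed.

Lemma Sigma_cM f g : Sigma_c f -> Sigma_c g -> Sigma_c (twist_conv f g).
Proof.
move=> Sf Sg; have [_ _ fE] := Sf; have [_ _ gE] := Sg.
have [s us fs] := Sigma_c_carried Sf; have [s' us' gs] := Sigma_c_carried Sg.
apply: carried_Sigma_c (carried_conv fE gE us' fs gs).
exact: equivariant_conv us' gs.
Qed.

Lemma Sigma_c_star f : Sigma_c f -> Sigma_c (invol f).
Proof.
move=> Sf; have [_ _ fE] := Sf; have [s us fs] := Sigma_c_carried Sf.
by apply: carried_Sigma_c (carried_invol fs); exact: equivariant_invol.
Qed.

Lemma Sigma_cP c f g : Sigma_c f -> Sigma_c g ->
  Sigma_c (fun x => c * f x + g x : C).
Proof.
move=> Sf Sg; have [_ _ fE] := Sf; have [_ _ gE] := Sg.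
have [s us fs] := Sigma_c_carried Sf; have [s' us' gs] := Sigma_c_carried Sg.
apply: (@carried_Sigma_c _ _ _ _ (s ++ s')) => [z x|x].
  by rewrite fE gE mulrDr mulrCA.
rewrite mem_cat; have [fx|/fs -> //] := eqVneq (f x) 0.
by rewrite fx mulr0 add0r => /gs ->; rewrite orbT.
Qed.

Lemma Sigma_c_delta x : Sigma_c (delta x).
Proof.
by apply: carried_Sigma_c; [exact: equivariant_delta|exact: carried_delta].
Qed.

(** An arbitrary choice of list, with default [[::]] when no finite list carries [f]; [integratedE]
    shows that the choice is immaterial. *)
Definition support f : seq G := xget [::] [set s | uniq s /\ carried f s].

Lemma carried_support f s : uniq s -> carried f s ->
  uniq (support f) /\ carried f (support f).
Proof.
move=> us fs.
by apply: (@xgetPex _ [::] [set s | uniq s /\ carried f s]); exists s.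
Qed.

End twisted_convolution.

(** * The integrated form *)

Lemma big_support (T : choiceType) (W : nmodType) (F : T -> W) (s s' : seq T) :
  uniq s -> uniq s' -> (forall a, F a != 0 -> a \in s) ->
  (forall a, F a != 0 -> a \in s') -> \sum_(a <- s) F a = \sum_(a <- s') F a.
Proof.
have filterE (r : seq T) :
    \sum_(a <- r) F a = \sum_(a <- [seq a <- r | F a != 0]) F a.
  rewrite big_filter [LHS]big_mkcond [RHS]big_mkcond.
  by apply: eq_bigr => a _; case: eqP.
move=> us us' Fs Fs'; rewrite filterE [RHS]filterE; apply: perm_big.
apply: uniq_perm; rewrite ?filter_uniq// => a; rewrite !mem_filter.
by case: (boolP (F a == 0)) => //= Fa; rewrite Fs ?Fs'.
Qed.

Section integrated_form.
Context (R : realType) (G : groupType) (E : twist R G).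
Context (A : unitalCstarAlgType R) (t : E -> A).
Hypothesis t_unitary : forall x : E, unitary (t x).
Hypothesis t_tact : forall (z : circle R) (x : E), t (tact z x) = (val z)^* *: t x.
Hypothesis tM : forall x y : E, cmul (t x) (t y) = t (x * y)%g.
Local Notation C := R[i].
Local Notation q := (@twist_q R G E).
Local Notation pt := (fibre_point E).
Implicit Types (x y : E) (z : circle R) (a b : G) (f g : E -> C) (s : seq G).

Let tMr x y : t x * t y = t (x * y)%g.
Proof. exact: tM. Qed.

(** A unitary idempotent is the identity. *)
Let t1 : t 1%g = 1.
Proof.
have [t1t _] := t_unitary 1%g; have : star (t 1%g) * (t 1%g * t 1%g) = 1.
  by rewrite tMr mulg1; exact: t1t.
by rewrite mulrA [star (t _) * _]t1t mul1r.
Qed.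

Let t_star x : star (t x) = t x^-1%g.
Proof.
have [tx _] := t_unitary x.
by rewrite -[LHS]mulr1 -t1 -(mulgV x) -tMr mulrA [star (t _) * _]tx mul1r.
Qed.

Definition integrated f : A := \sum_(a <- support f) f (pt a) *: t (pt a).

Let supp_term f s : carried f s ->
  forall a, f (pt a) *: t (pt a) != 0 -> a \in s.
Proof.
move=> fs a; rewrite scaler_eq0 => /norP[/fs].
by rewrite twist_q_fibre_point.
Qed.

Lemma integratedE f s : uniq s -> carried f s ->
  integrated f = \sum_(a <- s) f (pt a) *: t (pt a).
Proof.
move=> us fs; have [us' fs'] := carried_support us fs.
by apply: big_support => //; exact: supp_term.
Qed.

Lemma term_invariant f x y : equivariant f -> q x = q y ->
  f x *: t x = f y *: t y.
Proof.
move=> fE /twist_q_inj[z ->]; rewrite fE t_tact scalerA mulrAC.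
by rewrite circle_conj mulfV ?circle_neq0// mul1r.
Qed.

Lemma integratedP c f g : Sigma_c f -> Sigma_c g ->
  integrated (fun x => c * f x + g x) = c *: integrated f + integrated g.
Proof.
move=> /Sigma_c_carried[s us fs] /Sigma_c_carried[s' us' gs].
pose r := undup (s ++ s').
have ur : uniq r by exact: undup_uniq.
have fr : carried f r.
  by apply: carried_sub fs => a a_s; rewrite mem_undup mem_cat a_s.
have gr : carried g r.
  by apply: carried_sub gs => a a_s; rewrite mem_undup mem_cat a_s orbT.
have fgr : carried (fun x => c * f x + g x) r.
  move=> x; have [fx|/fr//] := eqVneq (f x) 0.
  by rewrite fx mulr0 add0r => /gr.
rewrite (integratedE ur fgr) (integratedE ur fr) (integratedE ur gr).
rewrite scaler_sumr -big_split /=; apply: eq_bigr => a _.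
by rewrite scalerDl scalerA.
Qed.

Lemma integratedM f g : Sigma_c f -> Sigma_c g ->
  integrated (twist_conv f g) = integrated f * integrated g.
Proof.
move=> Sf Sg; have [_ _ fE] := Sf; have [_ _ gE] := Sg.
have [s us fs] := Sigma_c_carried Sf; have [s' us' gs] := Sigma_c_carried Sg.
pose r := undup [seq (a * b)%g | a <- s, b <- s'].
have ur : uniq r by exact: undup_uniq.
have fgr : carried (twist_conv f g) r.
  apply: carried_sub (carried_conv fE gE us' fs gs) => a.
  by rewrite mem_undup.
rewrite (integratedE ur fgr) (integratedE us fs) (integratedE us' gs) mulr_sumr.
under eq_bigr => a _ do rewrite (twist_convE _ fE gE us' gs) scaler_suml.
rewrite exchange_big /= big_seq [RHS]big_seq; apply: eq_bigr => b b_s'.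
rewrite mulr_suml.
pose F a := f (pt a) *: t (pt a) * (g (pt b) *: t (pt b)).
(* For fixed [b], the substitution [c = a b] turns the sum over products into the sum over [a] in
   [s]; the extra indices give zero terms. *)
rewrite (eq_bigr (fun c => F (c * b^-1)%g)) => [|c _].
  rewrite -(big_map (fun c => c * b^-1)%g predT F).
  have Fs a : F a != 0 -> a \in s.
    move=> Fa; apply: (supp_term fs); apply: contraNneq Fa => ab.
    by rewrite /F ab mul0r.
  apply: big_support => //.
    by rewrite map_inj_uniq//; exact: mulIg.
  move=> a /Fs a_s; apply/mapP; exists (a * b)%g; last by rewrite mulgK.
  by rewrite mem_undup; apply/allpairsP; exists (a, b).
(* Fibre points need not be multiplicative, but these two elements share a fibre, so
   [term_invariant] exchanges them. *)
have qc : q (pt c * (pt b)^-1)%g = q (pt (c * b^-1)%g).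
  by rewrite twist_qM twist_qV !twist_q_fibre_point.
rewrite /F -(term_invariant fE qc) -scaleAl -scaleAr scalerA; congr (_ *: _).
by rewrite tMr mulgVK.
Qed.

Lemma integrated_star f : Sigma_c f ->
  integrated (invol f) = star (integrated f).
Proof.
move=> Sf; have [_ _ fE] := Sf; have [s us fs] := Sigma_c_carried Sf.
rewrite (@integratedE _ [seq a^-1%g | a <- s]); first last.
- exact: carried_invol.
- by rewrite map_inj_uniq//; exact: invg_inj.
rewrite (integratedE us fs) big_map.
rewrite (big_morph star (@starD R A) (star0 A)); apply: eq_bigr => a _.
have qa : q (pt a^-1)^-1%g = q (pt a).
  by rewrite twist_qV !twist_q_fibre_point invgK.
by rewrite -(term_invariant fE qa) starZ t_star invgK.
Qed.

Lemma integrated_delta x : integrated (delta x) = t x.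
Proof.
rewrite (@integratedE _ [:: q x])//; last exact: carried_delta.
rewrite big_seq1 (@term_invariant _ _ x); last by rewrite twist_q_fibre_point.
  by rewrite -{2}(tact1 x) delta_tact scale1r.
exact: equivariant_delta.
Qed.

(** Composing [integrated] with a representation of [A] that is large at [integrated f] gives one of
    the representations in the supremum. *)
Lemma integrated_le_full_norm f : Sigma_c f ->
  ((rnorm (integrated f))%:E <= full_norm f)%E.
Proof.
move=> Sf; have [H [rho [rho_cont rhoP rhoM rho_star rho_ge]]] :=
  gelfand_naimark (integrated f).
apply: (le_trans rho_ge); apply: ereal_sup_ubound.
exists H, (fun f => rho (integrated f)); split=> //; split.
- by move=> h _; exact: rho_cont.
- by move=> c g h Sg Sh v; rewrite integratedP// rhoP.
- by move=> g h Sg Sh v; rewrite integratedM// rhoM.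
- by move=> g Sg v w; rewrite integrated_star// rho_star.
Qed.

End integrated_form.

(** * Extension to the completion *)

(** [phi u] is the limit of [p (f n)] for [j (f n)] tending to [u]. The single inequality
    [|phi u - p f| <= |u - j f|] yields both the contraction property and the values on [j f]. *)
Lemma contraction_extension (R : realType) (T : Type) (V : normedModType R[i])
    (W : completeNormedModType R[i]) (S : set T) (j : T -> V) (p : T -> W) :
  (forall f g, S f -> S g -> rnorm (p f - p g) <= rnorm (j f - j g)) ->
  (forall u e, 0 < e -> exists2 f, S f & rnorm (u - j f) <= e) ->
  exists phi : V -> W, (forall u v, rnorm (phi u - phi v) <= rnorm (u - v)) /\
    forall f, S f -> phi (j f) = p f.
Proof.
move=> pj jd.
have /choice[phi phiP] : forall u, exists l, forall f, S f ->
    rnorm (l - p f) <= rnorm (u - j f).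
  move=> u; have /choice[f fP] : forall n, exists f,
      S f /\ rnorm (u - j f) <= rate R n.
    by move=> n; have [f ? ?] := jd u _ (rate_gt0 R n); exists f.
  have [e e0|l pl] := @rnorm_complete R W (fun n => p (f n)).
    have [N Ne] := rate_small (divr_gt0 e0 (ltr0Sn _ 1)).
    have fN n : (N <= n)%N -> rnorm (u - j (f n)) <= e / 2.
      move=> Nn; rewrite (le_trans (fP n).2)// (le_trans _ Ne)//.
      by rewrite lef_pV2 ?posrE// ler_nat ltnS.
    exists N => n m Nn Nm.
    rewrite (le_trans (pj _ _ (fP n).1 (fP m).1))// (le_trans (rdistD _ u _))//.
    by rewrite [leRHS]splitr lerD ?fN// rdistC fN.
  exists l => g Sg; apply/ler_addgt0Pr => e e0.
  have [N lN] := pl _ (divr_gt0 e0 (ltr0Sn _ 1)).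
  have [M Me] := rate_small (divr_gt0 e0 (ltr0Sn _ 1)).
  pose n := maxn N M.
  have nM : rate R n <= e / 2.
    by rewrite (le_trans _ Me)// lef_pV2 ?posrE// ler_nat ltnS leq_maxr.
  have := lN n (leq_maxl N M); have := pj _ _ (fP n).1 Sg.
  have := rdistD l (p (f n)) (p g); have := rdistD (j (f n)) u (j g).
  rewrite [rnorm (l - p (f n))]rdistC [rnorm (j (f n) - u)]rdistC.
  have := (fP n).2; lra.
exists phi; split=> [u v|f Sf]; last first.
  apply: rnorm_le_eps => e e0; rewrite (le_trans (phiP _ _ Sf))//.
  by rewrite subrr rnorm0 ltW.
apply/ler_addgt0Pr => e e0; have [f Sf fu] := jd u _ (divr_gt0 e0 (ltr0Sn _ 1)).
rewrite (le_trans (rdistD _ (p f) _))//.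
have := phiP u f Sf; have := phiP v f Sf; rewrite [rnorm (p f - _)]rdistC.
have := rdistD v u (j f); rewrite [rnorm (v - u)]rdistC.
lra.
Qed.

Theorem theorem3p2 (R : realType) (G : groupType) (E : twist R G)
    (countable_G : countable [set: G])
    (CGE : cstarAlgType R) (j : (E -> R[i]) -> CGE)
    (CGE_completion : is_full_completion j)
    (A : unitalCstarAlgType R) (t : E -> A)
    (t_unitary : forall x : E, unitary (t x))
    (t_tact : forall (z : circle R) (x : E), t (tact z x) = (val z)^* *: t x)
    (tM : forall x y : E, cmul (t x) (t y) = t (x * y)%g) :
  exists2 pi_t : {linear CGE -> A},
    is_star_hom pi_t & forall x : E, pi_t (j (delta x)) = t x.
Proof.
have [jP jM jS j_iso j_dense] := CGE_completion.
pose p := integrated t.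
have pP := @integratedP _ _ _ _ t.
have pM := integratedM t_tact tM.
have pS := integrated_star t_unitary t_tact tM.
have jB f g : Sigma_c f -> Sigma_c g -> Sigma_c (fun x => -1 * g x + f x) /\
    j f - j g = j (fun x => -1 * g x + f x).
  move=> Sf Sg; split; first exact: Sigma_cP.
  by rewrite jP// scaleN1r addrC.
have pj f g : Sigma_c f -> Sigma_c g -> rnorm (p f - p g) <= rnorm (j f - j g).
  move=> Sf Sg; have [Sfg ->] := jB _ _ Sf Sg.
  rewrite -lee_fin j_iso// /p addrC -scaleN1r -pP//.
  exact: integrated_le_full_norm.
have jd (u : CGE) e : 0 < e -> exists2 f, Sigma_c f & rnorm (u - j f) <= e.
  move=> e0; have [x [/= ux [f Sf fx]]] :
      ball u e%:C%C `&` (j @` @Sigma_c R G E) !=set0.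
    by apply: j_dense; [exists u; apply: ballxx|apply: ball_open]; rewrite ltcR.
  by exists f => //; move: ux; rewrite -fx -ball_normE /= rnorm_lt => /ltW.
have [phi [phi_lip phi_j]] := contraction_extension pj jd.
have r0 n : 0 <= rate R n by exact: ltW (rate_gt0 R n).
have r1 n : rate R n <= 1 by rewrite invf_le1// ler1n.
have phi_p u f : Sigma_c f -> rnorm (phi u - p f) <= rnorm (u - j f).
  by move=> Sf; rewrite -phi_j.
have phi_linear : linear phi.
  (* [phi (c u + v)] and [c (phi u) + phi v] are both within [(|c| + 1) * rate R n] of
     [p (c f + g)], for [f] and [g] approximating [u] and [v]. *)
  move=> c u v; apply: (@rnorm_rate_eq _ _ _ _ (2 * (rnorm c + 1))) => n.
  have [f Sf fu] := jd u _ (rate_gt0 R n).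
  have [g Sg gv] := jd v _ (rate_gt0 R n).
  have Sfg := Sigma_cP c Sf Sg.
  have lip (W : normedModType R[i]) (a b a' b' : W) :
      rnorm (a - a') <= rate R n -> rnorm (b - b') <= rate R n ->
      rnorm (c *: a + b - (c *: a' + b')) <= (rnorm c + 1) * rate R n.
    move=> aa bb; rewrite opprD addrACA -scalerBr (le_trans (rnormD _ _))//.
    rewrite mulrDl mul1r lerD// rnormZ ler_wpM2l//.
    exact: (rnorm_ge0 c).
  rewrite (le_trans (rdistD _ (p (fun x => c * f x + g x)) _))//.
  rewrite -mulrA mulr_natl mulr2n lerD//.
    by rewrite (le_trans (phi_p _ _ Sfg))// jP//; exact: lip.
  rewrite /p pP// rdistC; apply: lip.
    exact: le_trans (phi_p _ _ Sf) fu.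
  exact: le_trans (phi_p _ _ Sg) gv.
pose pi_t : {linear CGE -> A} :=
  HB.pack phi (GRing.isLinear.Build _ _ _ _ phi phi_linear).
exists pi_t; last first.
  by move=> x; rewrite /= phi_j ?/p ?integrated_delta//; exact: Sigma_c_delta.
split=> [u v|u] /=.
  (* One product estimate is used in [CGE] and one in [A], to compare both sides with
     [p (twist_conv f g)]; each [+ 1] bounds the rate in the norm of the approximant of the second
     factor. *)
  pose c := rnorm u + (rnorm v + 1) + (rnorm (phi u) + (rnorm (phi v) + 1)).
  apply: (@rnorm_rate_eq _ _ _ _ c) => n.
  have [f Sf fu] := jd u _ (rate_gt0 R n).
  have [g Sg gv] := jd v _ (rate_gt0 R n).
  have lip (B : cstarAlgType R) (a b a' b' : B) :
      rnorm (a - a') <= rate R n -> rnorm (b - b') <= rate R n ->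
      rnorm (cmul a b - cmul a' b') <= (rnorm a + (rnorm b + 1)) * rate R n.
    move=> aa bb; rewrite (le_trans (rnorm_cmul_dist _ _ _ _))// mulrDl lerD//.
      by rewrite ler_wpM2l// rnorm_ge0.
    rewrite mulrC ler_pM ?rnorm_ge0// -(subrK b b') (le_trans (rnormD _ _))//.
    by rewrite addrC lerD// rdistC (le_trans bb).
  rewrite (le_trans (rdistD _ (p (twist_conv f g)) _))// mulrDl lerD//.
    rewrite (le_trans (phi_p _ _ (Sigma_cM Sf Sg)))// jM//; exact: lip.
  rewrite /p pM// rdistC; apply: lip.
    exact: le_trans (phi_p _ _ Sf) fu.
  exact: le_trans (phi_p _ _ Sg) gv.
apply: (@rnorm_rate_eq _ _ _ _ 2) => n.
have [f Sf fu] := jd u _ (rate_gt0 R n).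
rewrite (le_trans (rdistD _ (p (invol f)) _))// mulr_natl mulr2n lerD//.
  rewrite (le_trans (phi_p _ _ (Sigma_c_star Sf)))// jS// -starB rnorm_star//.
by rewrite /p pS// -starB rnorm_star rdistC (le_trans (phi_p _ _ Sf)).
Qed.
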